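(* Let $d\ge5$ and $p>\frac{d}{d-2}$. Then for all positive integers $\lambda$ and all $f\in\ell^1(\mathbb{Z}^d)$, $g\in\ell^p(\mathbb{Z}^d)$, $$\|T_\lambda(f,g)\|_1 \lesssim \lambda^{-\frac{d}{2p}}\|f\|_1\|g\|_p.$$
   Context: $\|\cdot\|_p$ is the norm of $\ell^p(\mathbb{Z}^d)$ and $|\cdot|$ the Euclidean norm. The discrete bilinear spherical average is $$T_\lambda(f,g)(x) = \frac{1}{N(\lambda)} \sum_{\substack{u,v\in\mathbb{Z}^d\\ |u|^2+|v|^2=\lambda}} f(x-u)\,g(x-v),\qquad N(\lambda)=\#\{(u,v)\in\mathbb{Z}^d\times\mathbb{Z}^d:|u|^2+|v|^2=\lambda\}.$$ $X\lesssim Y$ means $X\le CY$ with $C$ depending only on $d$ and $p$ (not on $\lambda$, $f$, $g$). *)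

(* Defs.v *)
From HB Require Import structures.
From mathcomp Require Import all_boot all_order all_algebra finmap.
From mathcomp Require Import all_classical all_reals all_analysis.
From mathcomp Require Import complex.

Set Implicit Arguments.
Unset Strict Implicit.
Unset Printing Implicit Defensive.

Import Order.TTheory GRing.Theory Num.Theory.
Import numFieldNormedType.Exports.

Local Open Scope classical_set_scope.
Local Open Scope ring_scope.

(* An alias of 'rV[int]_d, so that it can carry the discrete sigma-algebra
   over which the counting measure is taken. *)
Definition lattice (d : nat) : Type := 'rV[int]_d.

HB.instance Definition _ (d : nat) := GRing.Zmodule.on (lattice d).
HB.instance Definition _ (d : nat) := isPointed.Build (lattice d) 0.
HB.instance Definition _ (d : nat) :=
  @isMeasurable.Build default_measure_display (lattice d) discrete_measurable
    discrete_measurable0 discrete_measurableC discrete_measurableU.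

Definition sqnorm (d : nat) (u : lattice d) : int :=
  \sum_(i < d) (u ord0 i) ^+ 2.

Definition bisphere (d lam : nat) : set (lattice d * lattice d) :=
  [set w | sqnorm w.1 + sqnorm w.2 = lam%:Z].
Arguments bisphere : clear implicits.

Lemma sqnorm_ge0 (d : nat) (u : lattice d) : 0 <= sqnorm u.
Proof. by apply: sumr_ge0 => i _; exact: sqr_ge0. Qed.

Lemma finite_sqnorm_le (d lam : nat) :
  finite_set [set u : lattice d | sqnorm u <= lam%:Z].
Proof.
pose F (h : {ffun 'I_d -> 'I_(lam.*2.+1)}) : lattice d :=
  \row_i ((h i)%:Z - lam%:Z).
apply: (@sub_finite_set _ _ (range F)); last exact: finite_image.
move=> u /= ule.
have ui i : `|u ord0 i| <= lam%:Z.
  have [->|uN0] := eqVneq (u ord0 i) 0; first by rewrite normr0.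
  apply: le_trans ule.
  rewrite /sqnorm (bigD1 i)//= -[leLHS]addr0 lerD//; last first.
    by apply: sumr_ge0 => j _; exact: sqr_ge0.
  by rewrite -real_normK ?num_real// expr2 ler_peMl// -gtz0_ge1 normr_gt0.
exists [ffun i => inord (absz (u ord0 i + lam%:Z)%R)] => //.
apply/rowP => i; rewrite mxE ffunE.
move: (ui i); rewrite ler_norml => /andP[ul uu].
have u0 : 0 <= u ord0 i + lam%:Z by rewrite -lerBlDr sub0r.
rewrite inordK; first by rewrite gez0_abs// addrK.
by rewrite ltnS -lez_nat gez0_abs// -addnn PoszD lerD2r.
Qed.

(* In particular the finitely supported sum and the fset_set cardinal below
   range over the whole set. *)
Lemma finite_bisphere (d lam : nat) : finite_set (bisphere d lam).
Proof.
apply: (@sub_finite_set _ _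
  ([set u : lattice d | sqnorm u <= lam%:Z] `*` [set u | sqnorm u <= lam%:Z])).
  by move=> [u v] /= <-; rewrite lerDl lerDr !sqnorm_ge0.
by apply: finite_setX; exact: finite_sqnorm_le.
Qed.

Definition bisphere_card (d lam : nat) : nat := #|` fset_set (bisphere d lam)|.

Definition bilinear_average (R : realType) (d lam : nat)
    (f g : lattice d -> R[i]) (x : lattice d) : R[i] :=
  (bisphere_card d lam)%:R^-1 *
  \sum_(w \in bisphere d lam) f (x - w.1) * g (x - w.2).

(* normc is the complex modulus with values in R, whereas `|z| lives in R[i].
   For p = +oo this is the supremum norm: only set0 is counting-null. *)
Definition lpnorm (R : realType) (d : nat) (p : \bar R)
    (f : lattice d -> R[i]) : \bar R :=
  Lnorm counting p (EFin \o (@ComplexField.Normc.normc R \o f)).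

Definition ellp (R : realType) (d : nat) (p : \bar R) :
    set (lattice d -> R[i]) :=
  [set f | (lpnorm p f < +oo)%E].

(* Main.v *)
Require Import Defs.
From mathcomp Require Import all_boot all_order all_algebra finmap.
From mathcomp Require Import all_classical all_reals all_analysis.
From mathcomp Require Import ess_sup_inf complex zify ring.

Set Implicit Arguments.
Unset Strict Implicit.
Unset Printing Implicit Defensive.

Import Order.TTheory GRing.Theory Num.Theory.
Import numFieldNormedType.Exports.

Local Open Scope classical_set_scope.
Local Open Scope ring_scope.

(** Write N for the number of points (u, v) of the sphere |u|^2 + |v|^2 = lam
    and m(w) for the number of those with u - v = w.  Substituting y = x - u
    turns the l^1 norm of the average into the sum over y of |f(y)| times the
    mean of |g(y + u - v)| over the sphere ([integral_average_le]).  By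
    convexity of the p-th power this mean is at most
    (max_w m(w) / N)^(1/p) ||g||_p ([sum_le_lpnorm]), so everything follows
    from the arithmetic estimate m(w) <= C lam^(-d/2) N, uniform in w
    ([fiber_decay]).

    A point of the fiber over w is determined by z = u + v, and
    |z|^2 = 2 lam - |w|^2.  Hence m(w) <= r_d(2 lam - |w|^2) while
    N = r_{2d}(lam), where r_k(n) counts representations of n by k squares.
    What is needed is r_d(n) <= C s^(d-2) for n <= s^2 ([rep_upper], d >= 5)
    and r_{2d}(n) >= c s^(2d-2) for n >= s^2 ([rep_lower], 2d >= 8).

    Both bounds start from Jacobi's theorem on four odd squares
    ([jacobi_odd4]): a positive n = 4 mod 8 has 16 sigma(n/4) representations
    by four odd squares, sigma being the sum of divisors.  Let A(n) be either
    side.  Then sum_x (M - 5 x^2) A(M - x^2) = 0, over odd x, for each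
    M = 5 mod 8, and as the coefficient of A(M - 1) is nonzero for M > 5 this
    determines A inductively.  For the count of representations the relation
    is the symmetry of the five coordinates of x_1^2 + ... + x_5^2 = M
    ([rep_recursion]).  For the divisor sums it says that a cubic polynomial
    has sum zero over Zagier's windmills x^2 + 4 y z = M, which follows from
    two linear substitutions ([sum_windmills_cubic]).

    Lower bound: a positive n = 4 mod 8 has at least n representations by four
    squares; four more variables in prescribed classes mod 4 remove the
    congruence condition ([rep8_lower]), and each variable gains a factor s.

    Upper bound: multiplication by 1 + i + j + k in the quaternions and a
    descent on the powers of 2 give r_4(n) <= 16 sigma(n) ([rep4_le]).  Summing
    over the fifth variable y leads to counting |y| <= s with y^2 = n mod e, for
    e <= s.  Two solutions y, z satisfy y = z or y = - z modulo some divisor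
    b >= sqrt e of e ([dvd_sqr_diff]), so there are at most
    sum_{a <= b, a b = e} 6 s / b of them, and r_5(n) <= C s^3 ([rep5_le])
    because the sum of 1 / (a b^2) over a <= b converges. *)

(** * Sums over lists without repetition *)

Definition zrange (n : int) : seq int :=
  [seq i%:Z - `|n|%N%:Z | i <- iota 0 `|n|.*2.+1].

Arguments zrange : simpl never.

Lemma mem_zrange (n x : int) : (x \in zrange n) = (`|x| <= `|n|).
Proof.
apply/mapP/idP => [[k]|xn]; first by rewrite mem_iota; lia.
by exists (absz (x + `|n|)); rewrite ?mem_iota; lia.
Qed.

Lemma uniq_zrange (n : int) : uniq (zrange n).
Proof. by rewrite map_inj_uniq ?iota_uniq// => i j; lia. Qed.

Lemma size_zrange (n : int) : size (zrange n) = `|n|.*2.+1.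
Proof. by rewrite size_map size_iota. Qed.

Definition zpos (n : int) : seq int := [seq i.+1%:Z | i <- iota 0 `|n|].

Arguments zpos : simpl never.

Lemma mem_zpos (n x : int) : (x \in zpos n) = (0 < x) && (x <= `|n|).
Proof.
apply/mapP/idP => [[k]|xn]; first by rewrite mem_iota; lia.
by exists `|x|.-1; rewrite ?mem_iota; lia.
Qed.

Lemma uniq_zpos (n : int) : uniq (zpos n).
Proof. by rewrite map_inj_uniq ?iota_uniq// => i j; lia. Qed.

Lemma big_seq_bij (V : Type) (idx : V) (op : Monoid.com_law idx)
    (S T : eqType) (s : seq S) (t : seq T) (h : S -> T) (h' : T -> S)
    (F : T -> V) :
  uniq s -> uniq t -> {in s, forall x, h x \in t} ->
  {in t, forall y, h' y \in s} ->
  {in s, cancel h h'} -> {in t, cancel h' h} ->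
  \big[op/idx]_(y <- t) F y = \big[op/idx]_(x <- s) F (h x).
Proof.
move=> us ut hs ht hK h'K; rewrite -(big_map h xpredT F).
apply: perm_big; apply: uniq_perm => //.
  by rewrite map_inj_in_uniq//; exact: can_in_inj hK.
move=> y; apply/idP/mapP => [yt|[x xs ->]]; last exact: hs.
by exists (h' y); [exact: ht | rewrite h'K].
Qed.

Lemma size_seq_inj (S T : eqType) (s : seq S) (t : seq T) (h : S -> T) :
  uniq s -> {in s, forall x, h x \in t} -> {in s &, injective h} ->
  (size s <= size t)%N.
Proof.
move=> us hs hI; rewrite -(size_map h); apply: uniq_leq_size.
  by rewrite map_inj_in_uniq.
by move=> y /mapP[x xs ->]; exact: hs.
Qed.

Lemma big_seq_support (V : Type) (idx : V) (op : Monoid.com_law idx)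
    (T : eqType) (s t : seq T) (F : T -> V) :
  uniq s -> uniq t -> {in s, forall x, x \notin t -> F x = idx} ->
  {in t, forall x, x \notin s -> F x = idx} ->
  \big[op/idx]_(x <- s) F x = \big[op/idx]_(x <- t) F x.
Proof.
move=> us ut Fs Ft.
rewrite (bigID (mem t)) [X in op _ X]big_seq_cond.
rewrite [X in op _ X]big1 ?Monoid.mulm1.
  rewrite [RHS](bigID (mem s)) [X in _ = op _ X]big_seq_cond.
  rewrite [X in _ = op _ X]big1 ?Monoid.mulm1.
    rewrite -big_filter -[RHS]big_filter; apply: perm_big; apply: uniq_perm.
    - exact: filter_uniq.
    - exact: filter_uniq.
    by move=> x; rewrite !mem_filter andbC.
  by move=> x /andP[]; exact: Ft.
by move=> x /andP[]; exact: Fs.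
Qed.

Lemma ler_sum_subset (R : numDomainType) (T : eqType) (s t : seq T)
    (F : T -> R) :
  uniq s -> uniq t -> {subset s <= t} -> {in t, forall x, 0 <= F x} ->
  \sum_(x <- s) F x <= \sum_(x <- t) F x.
Proof.
move=> us ut st F0; rewrite [leRHS](bigID (mem s))/= -[leLHS]addr0 lerD//.
  rewrite -[leRHS]big_filter.
  have P : perm_eq s [seq x <- t | x \in s].
    apply: uniq_perm => //; first by rewrite filter_uniq.
    by move=> x; rewrite mem_filter andb_idr// => /st.
  by rewrite (perm_big _ P).
by rewrite big_seq_cond; apply: sumr_ge0 => x /andP[/F0].
Qed.

(** * Representations by sums of squares *)

(** Coordinates are restricted to [D]; the range is wide enough because
    [x ^+ 2 <= n] forces [`|x| <= n]. *)
Fixpoint reps (D : pred int) (k : nat) (n : int) : seq (seq int) :=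
  if k is k'.+1 then
    [seq x :: t | x <- [seq x <- zrange n | D x], t <- reps D k' (n - x ^+ 2)]
  else if n == 0 then [:: [::]] else [::].

Arguments reps : simpl never.

Lemma repsS D k n : reps D k.+1 n =
  [seq x :: t | x <- [seq x <- zrange n | D x], t <- reps D k (n - x ^+ 2)].
Proof. by []. Qed.

Definition rep D k n : nat := size (reps D k n).

Lemma reps0 D n : reps D 0 n = if n == 0 then [:: [::]] else [::].
Proof. by []. Qed.

Lemma sumsq_ge0 (t : seq int) : 0 <= \sum_(x <- t) x ^+ 2.
Proof. by apply: sumr_ge0 => x _; exact: sqr_ge0. Qed.

Lemma mem_reps D k n (t : seq int) :
  (t \in reps D k n) =
  [&& size t == k, all D t & \sum_(x <- t) x ^+ 2 == n].
Proof.
elim: k n t => [|k IHk] n t.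
  rewrite reps0; have [->|n0] := eqVneq n 0; case: t => [|x t] //=.
    by rewrite big_nil eqxx.
  by rewrite big_nil eq_sym (negbTE n0).
rewrite repsS; apply/allpairsPdep/and3P => [[x [u [xn uk ->]]]|].
  move: uk xn; rewrite IHk mem_filter big_cons => /and3P[/= /eqP-> -> /eqP->].
  by rewrite andbT => /andP[-> _]; split => //; apply/eqP; ring.
case: t => [|x t] [] //; rewrite -[size _ == _]/(size t == k).
rewrite -[all _ _]/(D x && all D t) big_cons => tk /andP[Dx Dt] /eqP tn.
exists x, t; split=> //.
  rewrite mem_filter Dx/= mem_zrange -tn.
  have : `|x| <= x ^+ 2 by nia.
  move: (\sum_(j <- t) j ^+ 2) (sumsq_ge0 t) (x ^+ 2) => S S0 y.
  by lia.
by rewrite IHk tk Dt -tn; apply/eqP; ring.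
Qed.

Lemma uniq_reps D k n : uniq (reps D k n).
Proof.
elim: k n => [|k IHk] n; first by rewrite reps0; case: ifP.
rewrite repsS.
apply: allpairs_uniq_dep => //; first exact/filter_uniq/uniq_zrange.
by move=> [x t] [y u] _ _ /= [-> ->].
Qed.

Lemma repS D k n :
  rep D k.+1 n = (\sum_(x <- zrange n | D x) rep D k (n - x ^+ 2)%R)%N.
Proof.
rewrite /rep repsS size_allpairs_dep sumnE big_map big_filter; reflexivity.
Qed.

Lemma rep_neg D k n : n < 0 -> rep D k n = 0%N.
Proof.
move=> n0; apply/eqP; rewrite size_eq0; apply/eqP/nilP.
rewrite /nilp; case E : (reps D k n) => [//|t s].
have : t \in reps D k n by rewrite E mem_head.
by rewrite mem_reps => /and3P[_ _ /eqP]; have := sumsq_ge0 t; lia.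
Qed.

(** any interval containing the square roots does *)
(** Coordinates with [x ^+ 2 > n] leave a negative remainder, which has no
    representation, so the range of summation is immaterial beyond sqrt n. *)
Lemma repS_zrange D k n s : n <= s ^+ 2 ->
  rep D k.+1 n = (\sum_(x <- zrange s | D x) rep D k (n - x ^+ 2)%R)%N.
Proof.
move=> ns; rewrite repS -big_filter -[RHS]big_filter.
apply: big_seq_support; rewrite ?filter_uniq ?uniq_zrange// => x;
  rewrite !mem_filter => /andP[-> _]/=; rewrite mem_zrange => xr;
  apply: rep_neg; nia.
Qed.

Lemma rep_ge D k (n : int) (xs : seq int) B : uniq xs -> all D xs ->
  {in xs, forall x, (B <= rep D k (n - x ^+ 2))%N} ->
  (size xs * B <= rep D k.+1 n)%N.
Proof.
move=> us /allP Ds xB.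
have sE : (size xs * B = \sum_(x <- xs) B)%N.
  by rewrite big_const_seq count_predT iter_addn_0 mulnC.
apply: (@leq_trans (\sum_(x <- xs) rep D k (n - x ^+ 2))).
  by rewrite sE [leqLHS]big_seq [leqRHS]big_seq; apply: leq_sum.
pose L := [seq x :: t | x <- xs, t <- reps D k (n - x ^+ 2)].
have -> : (\sum_(x <- xs) rep D k (n - x ^+ 2)%R = size L)%N.
  by rewrite size_allpairs_dep sumnE big_map; reflexivity.
apply: (@size_seq_inj _ _ _ _ id) => //.
  apply: allpairs_uniq_dep => //; first by move=> x _; exact: uniq_reps.
  by move=> [x t] [y u] _ _ /= [-> ->].
move=> _ /allpairsPdep[x [t [xxs tk ->]]]; rewrite mem_reps /=.
move: tk; rewrite mem_reps => /and3P[/eqP-> -> /eqP tn].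
by rewrite (Ds _ xxs) eqxx big_cons tn addrC subrK eqxx.
Qed.

Lemma mem_reps_perm D k n (t u : seq int) : perm_eq t u ->
  (t \in reps D k n) = (u \in reps D k n).
Proof.
by move=> tu; rewrite !mem_reps (perm_size tu) (perm_all D tu) (perm_big _ tu).
Qed.

(** Summed over the representations of [n] by [k + 1] squares, the square of
    the first coordinate has the same total as that of any other one, namely
    the [k + 1]-st part of the total of [n]. *)
Lemma rep_recursion D k (n : int) :
  \sum_(x <- zrange n | D x) (n - k.+1%:Z * x ^+ 2) * (rep D k (n - x ^+ 2))%:Z
  = 0.
Proof.
pose S (F : seq int -> int) := \sum_(t <- reps D k.+1 n) F t.
have -> : \sum_(x <- zrange n | D x)
    (n - k.+1%:Z * x ^+ 2) * (rep D k (n - x ^+ 2))%:Z =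
    S (fun t => n - k.+1%:Z * (head 0 t) ^+ 2).
  rewrite /S repsS big_allpairs_dep big_filter; apply: eq_bigr => x _.
  by rewrite /= big_const_seq count_predT iter_addr_0 -mulr_natr natz.
rewrite /S sumrB -mulr_sumr.
have Si (i : 'I_k.+1) : S (fun t => (head 0 t) ^+ 2) =
    S (fun t => (nth 0 t i) ^+ 2).
  (* a cyclic shift of the coordinates brings the i-th one in front *)
  rewrite /S (@big_seq_bij _ _ _ _ _ (reps D k.+1 n) _ (rot i) (rotr i));
    rewrite ?uniq_reps//.
  - apply: eq_big_seq => t; rewrite mem_reps => /andP[/eqP st _].
    by rewrite -nth0 nth_cat size_drop st subn_gt0 ltn_ord nth_drop addn0.
  - move=> t; rewrite -(@mem_reps_perm D _ _ t (rot i t))//.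
    by rewrite perm_sym perm_rot.
  - move=> t; rewrite -(@mem_reps_perm D _ _ t (rotr i t))//.
    by rewrite perm_sym perm_rotr.
  - by move=> t _; rewrite rotK.
  - by move=> t _; rewrite rotrK.
have -> : k.+1%:Z * (\sum_(t <- reps D k.+1 n) head 0 t ^+ 2) =
    \sum_(i < k.+1) S (fun t => (nth 0 t i) ^+ 2).
  rewrite [RHS](eq_bigr (fun=> S (fun t => (head 0 t) ^+ 2))); last first.
    by move=> i _; exact: esym (Si i).
  by rewrite sumr_const card_ord -mulr_natl natz.
rewrite /S exchange_big/= -sumrB big_seq big1// => t.
rewrite mem_reps => /and3P[/eqP st _ /eqP <-].
by rewrite (big_nth 0) big_mkord st subrr.
Qed.

(** * Windmills and sums of divisors *)

Definition quarter_pairs (m : int) : seq (int * int) :=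
  [seq w <- [seq (y, z) | y <- zpos m, z <- zpos m] | 4 * (w.1 * w.2) == m].

Lemma mem_quarter_pairs m (w : int * int) :
  (w \in quarter_pairs m) = [&& 0 < w.1, 0 < w.2 & 4 * (w.1 * w.2) == m].
Proof.
rewrite mem_filter andbC; apply/andP/and3P.
  move=> [/allpairsP[[y z] /= [+ + ->]]]/=.
  by rewrite !mem_zpos => /andP[-> _] /andP[-> _].
case: w => y z [/= y0 z0 /eqP yz]; split; last exact/eqP.
by apply/allpairsP; exists (y, z); rewrite /= !mem_zpos; split => //; nia.
Qed.

Lemma uniq_quarter_pairs m : uniq (quarter_pairs m).
Proof.
apply: filter_uniq; apply: allpairs_uniq; rewrite ?uniq_zpos//.
by move=> [x y] [z t] _ _ /= [-> ->].
Qed.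

(** The sum of the divisors of [m / 4], and 0 unless [m] is a positive multiple
    of 4. *)
Definition sigma4 (m : int) : int := \sum_(w <- quarter_pairs m) w.1.

(** Zagier's windmills: the triples with [x ^+ 2 + 4 * (y * z) = n] and
    positive [y], [z]. *)
Definition windmills (n : int) : seq (int * (int * int)) :=
  [seq (x, w) | x <- zrange n, w <- quarter_pairs (n - x ^+ 2)].

Lemma mem_windmills n t : (t \in windmills n) =
  [&& 0 < t.2.1, 0 < t.2.2 & t.1 ^+ 2 + 4 * (t.2.1 * t.2.2) == n].
Proof.
case: t => x w /=; apply/allpairsPdep/and3P => [[y [v []]]|[w1 w2 /eqP xw]].
  move=> _; rewrite mem_quarter_pairs => /and3P[? ? /eqP ?] [-> ->].
  by split=> //; lia.
exists x, w; split=> //; first by rewrite mem_zrange; nia.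
by rewrite mem_quarter_pairs; apply/and3P; split => //; lia.
Qed.

Lemma uniq_windmills (n : int) : uniq (windmills n).
Proof.
apply: allpairs_uniq_dep; first exact: uniq_zrange.
  by move=> x _; exact: uniq_quarter_pairs.
by move=> [x y] [z t] _ _ /= [-> ->].
Qed.

Lemma sum_windmills (F : int * (int * int) -> int) n :
  \sum_(t <- windmills n) F t =
  \sum_(x <- zrange n) \sum_(w <- quarter_pairs (n - x ^+ 2)) F (x, w).
Proof. exact: big_allpairs_dep. Qed.

Lemma sum_windmills_odd (n : int) :
  \sum_(t <- windmills n) t.1 * t.2.1 ^+ 2 = 0.
Proof.
set S := LHS; suff : S = - S by lia.
rewrite /S -sumrN (@big_seq_bij _ _ _ _ _ (windmills n) _
  (fun t => (- t.1, t.2)) (fun t => (- t.1, t.2))) ?uniq_windmills//.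
- by apply: eq_bigr => t _ /=; rewrite mulNr.
- by move=> t; rewrite !mem_windmills/= sqrrN.
- by move=> t; rewrite !mem_windmills/= sqrrN.
- by move=> [x w] _ /=; rewrite opprK.
- by move=> [x w] _ /=; rewrite opprK.
Qed.

(** A windmill is an indefinite binary quadratic form [y, x, - z] of
    discriminant [n] whose outer coefficients have opposite signs.  Its value
    y + x - z at (1, 1) is nonzero because [n] is not a square, and [s]
    exchanges the windmills with positive and negative value.  On the negative
    ones, the translation (X, Y) |-> (X + Y, Y) followed by a change of sign of
    the middle coefficient is an involution [r], under which the summand,
    symmetrized by [s], changes sign. *)
Lemma sum_windmills_cubic (n : int) : (forall m : int, n <> m ^+ 2) ->
  \sum_(t <- windmills n) t.2.1 * (t.2.1 * t.2.2 - t.1 ^+ 2 - t.1 * t.2.1) = 0.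
Proof.
move=> nsq.
pose F (t : int * (int * int)) : int :=
  t.2.1 * (t.2.1 * t.2.2 - t.1 ^+ 2 - t.1 * t.2.1).
rewrite -[LHS]/(\sum_(t <- windmills n) F t).
pose neg (t : int * (int * int)) := t.1 + t.2.1 - t.2.2 < 0.
pose s (t : int * (int * int)) : int * (int * int) := (- t.1, (t.2.2, t.2.1)).
pose r (t : int * (int * int)) : int * (int * int) :=
  (- t.1 - 2 * t.2.1, (t.2.1, t.2.2 - t.1 - t.2.1)).
pose W := [seq t <- windmills n | neg t].
have uW : uniq W by rewrite filter_uniq ?uniq_windmills.
have W0 t : t \in windmills n -> t.1 + t.2.1 - t.2.2 != 0.
  rewrite mem_windmills => /and3P[_ _ /eqP tn]; apply/eqP => t0.
  apply: (nsq (t.2.1 + t.2.2)); rewrite -tn.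
  by have -> : t.1 = t.2.2 - t.2.1; lia.
have -> : \sum_(t <- windmills n) F t = \sum_(t <- W) (F t + F (s t)).
  rewrite [RHS]big_split [LHS](bigID neg)/= -[X in X + _]big_filter.
  congr (_ + _).
  rewrite -big_filter (@big_seq_bij _ _ _ _ _ W _ s s);
    rewrite ?filter_uniq ?uniq_windmills//.
  - move=> t; rewrite !mem_filter !mem_windmills /neg/= => /and4P[? ? ? /eqP <-].
    by apply/and4P; split=> //; [lia|apply/eqP; ring].
  - move=> t; rewrite !mem_filter => /andP[tn tw].
    have := W0 _ tw; move: tw tn; rewrite !mem_windmills /neg/=.
    move=> /and3P[? ? /eqP <-] ? ?.
    by apply/and4P; split=> //; [lia|apply/eqP; ring].
  - by move=> [x [y z]] _ /=; rewrite /s/= opprK.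
  - by move=> [x [y z]] _ /=; rewrite /s/= opprK.
set S := LHS; suff : S = - S by lia.
rewrite /S -sumrN (@big_seq_bij _ _ _ _ _ W _ r r);
  rewrite ?filter_uniq ?uniq_windmills//.
- by apply: eq_bigr => -[x [y z]] _ /=; rewrite /F /r /s/=; ring.
- move=> t; rewrite !mem_filter !mem_windmills /neg/= => /and4P[? ? ? /eqP <-].
  by apply/and4P; split=> //; [lia|lia|apply/eqP; ring].
- move=> t; rewrite !mem_filter !mem_windmills /neg/= => /and4P[? ? ? /eqP <-].
  by apply/and4P; split=> //; [lia|lia|apply/eqP; ring].
- by move=> [x [y z]] _ /=; rewrite /r/=; congr (_, (_, _)); ring.
- by move=> [x [y z]] _ /=; rewrite /r/=; congr (_, (_, _)); ring.
Qed.

(** On a windmill, n - 5 x^2 = 4 (y z - x^2); multiplied by y this is four times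
    the cubic polynomial above plus 4 x y^2, which is odd in x. *)
Lemma sigma4_recursion (n : int) : (forall m : int, n <> m ^+ 2) ->
  \sum_(x <- zrange n) (n - 5 * x ^+ 2) * sigma4 (n - x ^+ 2) = 0.
Proof.
move=> nsq.
have -> : \sum_(x <- zrange n) (n - 5 * x ^+ 2) * sigma4 (n - x ^+ 2) =
    \sum_(t <- windmills n) 4 * (t.2.1 * (t.2.1 * t.2.2 - t.1 ^+ 2 - t.1 * t.2.1)
                             + t.1 * t.2.1 ^+ 2).
  rewrite sum_windmills; apply: eq_bigr => x _; rewrite mulr_sumr.
  apply: eq_big_seq => w; rewrite mem_quarter_pairs => /and3P[_ _ /eqP wn].
  have -> : n = 4 * (w.1 * w.2) + x ^+ 2 by rewrite wn subrK.
  by rewrite /=; ring.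
by rewrite -mulr_sumr big_split/= sum_windmills_odd sum_windmills_cubic.
Qed.

(** * Jacobi's theorem for four odd squares *)

Definition oddz (x : int) : bool := odd `|x|.

Lemma oddz_sqr x : oddz x -> exists q, x ^+ 2 = 8 * q + 1.
Proof.
move=> ox; have [k xk] : exists k : int, x = 2 * k + 1.
  by exists ((x - 1) %/ 2)%Z; rewrite /oddz in ox; lia.
have [j kj] : exists j : int, k * (k + 1) = 2 * j.
  exists ((k * (k + 1)) %/ 2)%Z.
  have [h [kh|kh]] : exists h : int, k = 2 * h \/ k = 2 * h + 1.
    by exists (k %/ 2)%Z; lia.
    by nia.
  by nia.
by exists j; rewrite xk; nia.
Qed.

Lemma sum_odd_sqr (t : seq int) : all oddz t ->
  exists q : int, \sum_(x <- t) x ^+ 2 = 8 * q + (size t)%:Z.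
Proof.
elim: t => [|x t IHt] /=; first by exists 0; rewrite big_nil.
move=> /andP[/oddz_sqr[i xi] /IHt[j tj]]; exists (i + j).
by rewrite big_cons xi tj; lia.
Qed.

Lemma rep_odd4_eq0 (n : int) : (forall q, n <> 8 * q + 4) -> rep oddz 4 n = 0%N.
Proof.
move=> nq; rewrite /rep; case E : (reps oddz 4 n) => [//|t s].
have : t \in reps oddz 4 n by rewrite E mem_head.
rewrite mem_reps => /and3P[/eqP st /sum_odd_sqr[q tq] /eqP tn].
by case: (nq q); rewrite -tn tq st.
Qed.

Lemma sigma4_eq0 (n : int) : (forall q, 0 < q -> n <> 4 * q) -> sigma4 n = 0.
Proof.
move=> nq; rewrite /sigma4 big_seq big1// => w.
rewrite mem_quarter_pairs => /and3P[? ? /eqP wn].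
by case: (nq (w.1 * w.2)); rewrite ?mulr_gt0.
Qed.

Lemma rep_odd4_base : (rep oddz 4 4)%:Z = 16 * sigma4 4.
Proof.
have -> : sigma4 4 = 1.
  rewrite /sigma4; have -> : quarter_pairs 4 = [:: (1, 1)] by vm_compute.
  by rewrite big_seq1.
have step k (n : int) : n <= 4 ->
    rep oddz k.+1 n = (rep oddz k (n - 1) + rep oddz k (n - 1))%N.
  move=> n4; rewrite (@repS_zrange oddz k n 2)// -big_filter.
  have -> : [seq x <- zrange 2 | oddz x] = [:: -1; 1] by [].
  by rewrite !big_cons big_nil sqrrN expr1n addn0.
by rewrite !step.
Qed.

(** Induction on [n]: in the two recursions at [n + 1], all terms with
    [x ^+ 2 > 1] agree by induction, so the terms [x = 1] and [x = -1] agree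
    too; their coefficient [n - 4] is nonzero except in the base case. *)
Lemma jacobi_odd4 (n : int) : (exists q, n = 8 * q + 4) ->
  (rep oddz 4 n)%:Z = 16 * sigma4 n.
Proof.
elim: {n}`|n|%N {-2}n (leqnn `|n|) => [|m IH] n nm [q nq].
  by exfalso; lia.
have [n0|n0] := leP n 0.
  rewrite rep_neg ?sigma4_eq0 ?mulr0//; first by move=> r r0; lia.
  by lia.
have [n4|n4] := eqVneq n 4; first by rewrite n4 rep_odd4_base.
(* N = 5 mod 8 is not a square, as sigma4_recursion requires *)
pose N := n + 1.
pose D x := (rep oddz 4 (N - x ^+ 2))%:Z - 16 * sigma4 (N - x ^+ 2).
have nsq (k : int) : N <> k ^+ 2.
  rewrite /N nq; have [/oddz_sqr[j ->]|] := boolP (oddz k); first by lia.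
  rewrite /oddz => ek; have [j ->] : exists j, k = 2 * j.
    by exists (k %/ 2)%Z; lia.
  by rewrite exprMn; lia.
have sD : \sum_(x <- zrange N | oddz x) (N - 5 * x ^+ 2) * D x = 0.
  have rN : \sum_(x <- zrange N | oddz x)
      (N - 5 * x ^+ 2) * (rep oddz 4 (N - x ^+ 2))%:Z = 0.
    exact: (rep_recursion oddz 4 N).
  rewrite /D; under eq_bigr do rewrite mulrBr [X in _ - X]mulrCA.
  rewrite sumrB rN sub0r -mulr_sumr.
  rewrite -[RHS]oppr0; congr (- _); rewrite -[RHS](mulr0 16); congr (16 * _).
  rewrite -[RHS](sigma4_recursion nsq) [RHS](bigID oddz)/=.
  rewrite [X in _ = _ + X]big1 ?addr0//.
  move=> x ex; rewrite sigma4_eq0 ?mulr0// => r r0.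
  have [j ->] : exists j, x = 2 * j.
    by exists (x %/ 2)%Z; rewrite /oddz in ex; lia.
  by rewrite exprMn /N; lia.
have : \sum_(x <- [:: 1; -1]) (N - 5 * x ^+ 2) * D x = 0.
  rewrite -[RHS]sD -[RHS]big_filter; apply: big_seq_support => //.
  - by rewrite filter_uniq ?uniq_zrange.
  - move=> x; rewrite !inE mem_filter mem_zrange => /orP[] /eqP-> /=;
    by rewrite /N; lia.
  - move=> x; rewrite !inE mem_filter => /andP[ox _] xN1.
    have x4 : 4 <= x ^+ 2.
      by move: ox xN1; rewrite /oddz negb_or => ? /andP[/eqP ? /eqP ?]; nia.
    rewrite /D; have [Nx|Nx] := ltP (N - x ^+ 2) 0.
      rewrite rep_neg// sigma4_eq0 ?mulr0 ?subrr ?mulr0// => r r0.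
      by move: Nx; rewrite /N; lia.
    rewrite IH ?subrr ?mulr0//; first by move: Nx; rewrite /N; lia.
    have [j xj] := oddz_sqr ox; exists (q - j).
    by rewrite /N nq xj; lia.
rewrite !big_cons big_nil /D sqrrN !expr1n addr0 /N addrK.
by move: (rep _ _ _) (sigma4 _) => r s; nia.
Qed.

(** * Four squares *)

Lemma sigma4_ge0 (n : int) : 0 <= sigma4 n.
Proof.
rewrite /sigma4 big_seq; apply: sumr_ge0 => w.
by rewrite mem_quarter_pairs => /and3P[/ltW].
Qed.

Lemma rep_odd4_le (n : int) : (rep oddz 4 n)%:Z <= 16 * sigma4 n.
Proof.
have [/eqP nq|/eqP nq] := boolP (n == 8 * ((n - 4) %/ 8)%Z + 4).
  by rewrite jacobi_odd4//; exists ((n - 4) %/ 8)%Z.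
by rewrite rep_odd4_eq0 ?mulr_ge0 ?sigma4_ge0// => q nE; apply: nq; lia.
Qed.

Lemma sum_sqr4 (a b c d : int) :
  \sum_(x <- [:: a; b; c; d]) x ^+ 2 = a ^+ 2 + b ^+ 2 + c ^+ 2 + d ^+ 2.
Proof. by rewrite !big_cons big_nil addr0 !addrA. Qed.

Lemma reps4P D (n : int) (t : seq int) : t \in reps D 4 n ->
  exists a b c d, [/\ t = [:: a; b; c; d], [&& D a, D b, D c & D d] &
    a ^+ 2 + b ^+ 2 + c ^+ 2 + d ^+ 2 = n].
Proof.
rewrite mem_reps; case: t => [|a [|b [|c [|d [|e t]]]]] // /and3P[_ + /eqP].
rewrite sum_sqr4 /= andbT => Dt tn; exists a, b, c, d; split=> //.
Qed.

(** [h] is right multiplication of the quaternion a + b i + c j + d k by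
    1 + i + j + k: it multiplies the norm by 4, and every coordinate of the
    product has the parity of a + b + c + d, that is, of the norm [n]. *)
Lemma rep4_odd_le (n : int) : oddz n -> (rep predT 4 n <= rep oddz 4 (4 * n))%N.
Proof.
move=> on.
pose h (t : seq int) := let: (a, b, c, d) := (t`_0, t`_1, t`_2, t`_3) in
  [:: a - b - c - d; a + b + c - d; a - b + c + d; a + b - c + d].
apply: (@size_seq_inj _ _ _ _ h); first exact: uniq_reps.
  move=> t /reps4P[a [b [c [d [-> _ abcd]]]]].
  rewrite mem_reps /h /= sum_sqr4; apply/andP; split; last first.
    by rewrite -abcd; apply/eqP; ring.
  have sq (x : int) : exists q, x ^+ 2 = x + 2 * q.
    have [j [->|->]] : exists j, x = 2 * j \/ x = 2 * j + 1.
    - by exists (x %/ 2)%Z; lia.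
    - by exists (j * (2 * j - 1)); ring.
    - by exists (j * (2 * j + 1)); ring.
  have [i ai] := sq a; have [j bj] := sq b.
  have [k ck] := sq c; have [l dl] := sq d.
  have [r nr] : exists r, n = 2 * r + 1.
    by exists ((n - 1) %/ 2)%Z; rewrite /oddz in on; lia.
  have [m sm] : exists m, a + b + c + d = 2 * m + 1.
    exists (r - i - j - k - l); move: abcd; rewrite ai bj ck dl nr.
    by clear on; lia.
  have odd2 (x q : int) : x = 2 * q + 1 -> oddz x.
    by move=> ->; rewrite /oddz; lia.
  apply/and5P; split=> //.
  - by apply: (odd2 _ (m - b - c - d)); lia.
  - by apply: (odd2 _ (m - d)); lia.
  - by apply: (odd2 _ (m - b)); lia.
  - by apply: (odd2 _ (m - c)); lia.
move=> t u /reps4P[a [b [c [d [-> _ _]]]]] /reps4P[a' [b' [c' [d' [-> _ _]]]]].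
by rewrite /h /= => -[? ? ? ?]; congr [:: _; _; _; _]; lia.
Qed.

Lemma rep4_double (n : int) : (rep predT 4 n <= rep predT 4 (2 * n))%N.
Proof.
pose h (t : seq int) := let: (a, b, c, d) := (t`_0, t`_1, t`_2, t`_3) in
  [:: a + b; a - b; c + d; c - d].
apply: (@size_seq_inj _ _ _ _ h); first exact: uniq_reps.
  move=> t /reps4P[a [b [c [d [-> _ abcd]]]]].
  rewrite mem_reps /h /= sum_sqr4.
  by rewrite -abcd; apply/eqP; ring.
move=> t u /reps4P[a [b [c [d [-> _ _]]]]] /reps4P[a' [b' [c' [d' [-> _ _]]]]].
by rewrite /h /= => -[? ? ? ?]; congr [:: _; _; _; _]; lia.
Qed.

(** Modulo 4, a sum of four squares vanishes only if all of them are odd or all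
    are even; in the second case the coordinates can be halved. *)
Lemma rep4_quadruple (n : int) :
  (rep predT 4 (4 * n) <= rep oddz 4 (4 * n) + rep predT 4 n)%N.
Proof.
rewrite /rep -(count_predC (all oddz)) -!size_filter leq_add//.
  apply: (@size_seq_inj _ _ _ _ id) => //.
    by rewrite filter_uniq ?uniq_reps.
  move=> t; rewrite mem_filter !mem_reps => /andP[ot /and3P[-> _ ->]].
  by rewrite ot.
pose h (t : seq int) := [seq (x %/ 2)%Z | x <- t].
have ev t : t \in [seq t <- reps predT 4 (4 * n) | predC (all oddz) t] ->
    exists a b c d, t = [:: 2 * a; 2 * b; 2 * c; 2 * d] /\
      a ^+ 2 + b ^+ 2 + c ^+ 2 + d ^+ 2 = n.
  rewrite mem_filter => /andP[+ /reps4P[a [b [c [d [tE _ abcd]]]]]].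
  rewrite {}tE.
  rewrite -[predC _ _]/(~~ [&& oddz a, oddz b, oddz c, oddz d & true]) => ev.
  have P (x : int) : (exists i, x = 2 * i) \/
      (oddz x /\ exists q, x ^+ 2 = 4 * q + 1).
    have [/[dup] ox /oddz_sqr[q ->]|] := boolP (oddz x).
      by right; split => //; exists (2 * q); lia.
    by rewrite /oddz => ?; left; exists (x %/ 2)%Z; lia.
  have [[i ai]|[oa [i ai]]] := P a; have [[j bj]|[ob [j bj]]] := P b;
  have [[k ck]|[oc [k ck]]] := P c; have [[l dl]|[od [l dl]]] := P d;
  move: abcd; rewrite ai bj ck dl => abcd; try (exfalso; lia).
  by exists i, j, k, l; split=> //; move: abcd; rewrite !exprMn; lia.
apply: (@size_seq_inj _ _ _ (reps predT 4 n) h).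
- by rewrite filter_uniq ?uniq_reps.
- move=> t /ev[a [b [c [d [-> abcd]]]]].
  by rewrite mem_reps /h /= ![2 * _]mulrC !mulzK// sum_sqr4 abcd eqxx.
- move=> t u /ev[a [b [c [d [-> _]]]]] /ev[a' [b' [c' [d' [-> _]]]]].
by rewrite /h /= ![2 * _]mulrC !mulzK// => -[-> -> -> ->].
Qed.

Lemma sigma4_double (n : int) : 2 * sigma4 n <= sigma4 (2 * n).
Proof.
pose h (w : int * int) := (2 * w.1, w.2).
have -> : 2 * sigma4 n = \sum_(w <- [seq h w | w <- quarter_pairs n]) w.1.
  by rewrite big_map /sigma4 mulr_sumr.
apply: ler_sum_subset; rewrite ?uniq_quarter_pairs//.
- rewrite map_inj_uniq ?uniq_quarter_pairs// => -[a b] [c d] [/= ? ->].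
  by congr (_, _); lia.
- move=> w /mapP[v + ->]; rewrite !mem_quarter_pairs /h /= => /and3P[? ? /eqP <-].
  by apply/and3P; split=> //; lia.
- by move=> w; rewrite mem_quarter_pairs => /and3P[/ltW].
Qed.

(** For [n = 2 * k] the chain is r_4(n) <= r_4(2n) = r_4(4k), which is at most
    the number of odd representations of 4k plus r_4(k); the factor 2 of
    [sigma4_double] absorbs the two resulting terms. *)
Lemma rep4_le (n : int) : 0 < n -> (rep predT 4 n)%:Z <= 16 * sigma4 (4 * n).
Proof.
elim: {n}`|n|%N {-2}n (leqnn `|n|) => [|m IH] n nm n0; first by lia.
have [on|] := boolP (oddz n).
  apply: le_trans (rep_odd4_le _); rewrite lez_nat; exact: rep4_odd_le.
rewrite /oddz => en; have [k nk] : exists k : int, n = 2 * k.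
  by exists (n %/ 2)%Z; lia.
have k0 : 0 < k by lia.
have {}IH : (rep predT 4 k)%:Z <= 16 * sigma4 (4 * k) by apply: IH; lia.
have := rep4_quadruple k; have := rep_odd4_le (4 * k).
have := rep4_double n; have := sigma4_double (4 * k).
have -> : 2 * n = 4 * k by lia.
have -> : 2 * (4 * k) = 4 * n by lia.
by lia.
Qed.

(** * Five squares *)

(** 1 / (n + 1)^2 <= 1 / n - 1 / (n + 1), so the sum telescopes. *)
Lemma sum_inv_sqr_tail (a n : nat) : (0 < a)%N ->
  \sum_(a <= b < n) (b%:R ^- 2 : rat) <= 2 / a%:R.
Proof.
move=> a0.
have [na|an] := leqP n a.
  by rewrite big_geq// divr_ge0.
suff : \sum_(a <= b < n) (b%:R ^- 2 : rat) <= 2 / a%:R - n.-1%:R^-1.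
  by move/le_trans; apply; rewrite lerBlDr lerDl invr_ge0.
case: n an => // n; rewrite ltnS -[n.+1.-1]/n => an.
elim: n an => [|n IH] an; first by lia.
have [{}an|an'] := leqP a n.
  rewrite big_nat_recr/=; last by lia.
  apply: le_trans (lerD (IH an) (lexx _)) _.
  rewrite -addrA lerD2l lerNr opprD opprK addrC.
  have n0 : 0 < n%:R :> rat by rewrite ltr0n; lia.
  rewrite -natr1 -subr_ge0 (_ : _ - _ = (n%:R * (n%:R + 1) ^+ 2)^-1); last first.
    by field; rewrite !gt_eqF ?addr_gt0.
  by rewrite invr_ge0 mulr_ge0 ?sqr_ge0 ?ltW.
have -> : a = n.+1 by lia.
rewrite big_nat1.
have n0 : 0 < n.+1%:R :> rat by rewrite ltr0n.
have n1 : 1 <= n.+1%:R :> rat by rewrite ler1n.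
move: (n.+1%:R) n0 n1 => x x0 x1.
rewrite -[X in _ - X]mul1r -mulrBl (_ : 2 - 1 = 1 :> rat)// mul1r.
rewrite lef_pV2 ?posrE ?exprn_gt0//.
by rewrite expr2 ler_peMl // ltW.
Qed.

Lemma sum_inv_triangle (s : nat) :
  \sum_(1 <= a < s.+1) \sum_(1 <= b < s.+1 | (a <= b)%N)
    ((a%:R * b%:R ^+ 2)^-1 : rat) <= 4.
Proof.
apply: (@le_trans _ _ (\sum_(1 <= a < s.+1) 2 * (a%:R ^- 2 : rat))).
  apply: ler_sum_nat => a /andP[a0 _].
  have -> : \sum_(1 <= b < s.+1 | (a <= b)%N) ((a%:R * b%:R ^+ 2)^-1 : rat) =
     a%:R^-1 * \sum_(a <= b < s.+1) b%:R ^- 2.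
    rewrite mulr_sumr [RHS](big_nat_widenl _ 1%N)//=.
    by apply: eq_bigr => b _; rewrite invfM.
  apply: (@le_trans _ _ (a%:R^-1 * (2 / a%:R))).
    by rewrite ler_wpM2l ?invr_ge0// sum_inv_sqr_tail.
  by rewrite mulrCA expr2 invfM.
rewrite -mulr_sumr.
apply: le_trans (ler_wpM2l _ (sum_inv_sqr_tail s.+1 (ltn0Sn 0))) _ => //.
Qed.

Lemma size_progression (s b : nat) (c : int) : (0 < b)%N -> (b <= s)%N ->
  (size [seq y <- zrange s | (b%:Z %| (y - c)%R)%Z] * b <= 3 * s)%N.
Proof.
move=> b0 bs; pose h (y : int) := absz ((y + s%:Z) %/ b)%Z.
have b0' : b%:Z != 0 by lia.
have q0 x : `|x| <= `|s%:Z| -> 0 <= ((x + s%:Z) %/ b)%Z.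
  by move=> xs; rewrite divz_ge0; lia.
have : (size [seq y <- zrange s | (b%:Z %| (y - c)%R)%Z] <=
        size (iota 0 ((2 * s) %/ b).+1))%N.
  apply: (@size_seq_inj _ _ _ _ h); first by rewrite filter_uniq ?uniq_zrange.
    move=> y; rewrite mem_filter mem_zrange mem_iota => /andP[_ ys].
    rewrite /= add0n ltnS leq_divRL// /h.
    rewrite -lez_nat PoszM.
    have := divz_eq (y + s%:Z) b; have := modz_ge0 (y + s%:Z) b0'.
    have := q0 _ ys.
    by move: (_ %/ _)%Z (_ %% _)%Z => q r; lia.
  move=> y z; rewrite !mem_filter !mem_zrange => /andP[yb ys] /andP[zb zs].
  rewrite /h => yz.
  have [k yk] : exists k, y - z = k * b%:Z.
    have /dvdzP[k kE] : (b%:Z %| (y - c) - (z - c))%Z by rewrite rpredB.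
    by exists k; rewrite -kE; ring.
  have yz' : ((y + s%:Z) %/ b)%Z = ((z + s%:Z) %/ b)%Z.
    by rewrite -(gez0_abs (q0 _ ys)) -(gez0_abs (q0 _ zs)) yz.
  have : y + s%:Z = k * b%:Z + (z + s%:Z) by rewrite -yk; ring.
  move=> yE; move: yz'; rewrite yE divzMDl// => k0.
  have {}k0 : k = 0 by apply: (addIr (((z + s%:Z) %/ b)%Z)); rewrite k0 add0r.
  by move: yk; rewrite k0 mul0r => /subr0_eq.
rewrite size_iota => H; apply: leq_trans (leq_mul H (leqnn b)) _.
have := leq_trunc_div (2 * s) b.
by rewrite mulSn; lia.
Qed.

(** With g = gcd(e, y - z), the cofactor e / g divides y + z; of the two
    complementary divisors g and e / g of e the larger one is [b]. *)
Lemma dvd_sqr_diff (e : nat) (n y z : int) : (0 < e)%N ->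
  (e%:Z %| n - y ^+ 2)%Z -> (e%:Z %| n - z ^+ 2)%Z ->
  exists a b : nat, [/\ (0 < a)%N, (a <= b)%N, (a * b = e)%N &
    (b%:Z %| y - z)%Z || (b%:Z %| y + z)%Z].
Proof.
move=> e0 ey ez.
have : (e%:Z %| (y - z) * (y + z))%Z.
  have -> : (y - z) * (y + z) = (n - z ^+ 2) - (n - y ^+ 2) by ring.
  by rewrite rpredB.
rewrite !dvdzE abszM => eyz.
set g := gcdn e (absz (y - z)%R).
have g0 : (0 < g)%N by rewrite gcdn_gt0 e0.
have ge : (g %| e)%N := dvdn_gcdl _ _.
have gy : (g %| (absz (y - z)%R))%N := dvdn_gcdr _ _.
have fy : (e %/ g %| (absz (y + z)%R))%N.
  rewrite -(@Gauss_dvdr _ ((absz (y - z)%R) %/ g)); last first.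
    rewrite /coprime -(eqn_pmul2r g0) muln_gcdl !divnK//.
    by rewrite mul1n.
  by rewrite -(dvdn_pmul2r g0) divnK// mulnAC divnK.
have f0 : (0 < e %/ g)%N by rewrite divn_gt0// dvdn_leq.
have [gf|fg] := leqP g (e %/ g).
  exists g, (e %/ g)%N; split=> //; first by rewrite mulnC divnK.
  by rewrite !dvdzE fy orbT.
exists (e %/ g)%N, g; split=> //; [exact: ltnW | exact: divnK |].
by rewrite !dvdzE gy.
Qed.

(** Relative to one fixed root z, each root y lies in the class of z or of - z
    modulo a divisor b as in [dvd_sqr_diff], and a class modulo [b <= s] has at
    most 3 s / b members in the range. *)
Lemma count_sqr_roots (s e : nat) (n : int) : (0 < e)%N -> (e <= s)%N ->
  ((size [seq y <- zrange s | (e%:Z %| (n - y ^+ 2)%R)%Z])%:R : rat) <=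
  \sum_(1 <= a < s.+1) \sum_(1 <= b < s.+1 | (a <= b)%N && (a * b == e)%N)
     (6 * s)%:R / b%:R.
Proof.
move=> e0 es; set Y := [seq y <- _ | _].
have nng : 0 <= \sum_(1 <= a < s.+1)
    \sum_(1 <= b < s.+1 | (a <= b)%N && (a * b == e)%N) (6 * s)%:R / b%:R :> rat.
  by apply: sumr_ge0 => a _; apply: sumr_ge0 => b _; rewrite divr_ge0.
case EY : Y => [//|z Y'].
have zY : (e%:Z %| n - z ^+ 2)%Z.
  have : z \in Y by rewrite EY mem_head.
  by rewrite /Y mem_filter => /andP[].
rewrite -{}EY -sum1_size natr_sum.
pose G (y : int) (b : nat) : rat :=
  (b%:Z %| y - z)%Z%:R + (b%:Z %| y + z)%Z%:R.
apply: (@le_trans _ _ (\sum_(y <- Y) \sum_(1 <= a < s.+1)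
    \sum_(1 <= b < s.+1 | (a <= b)%N && (a * b == e)%N) G y b)).
  rewrite big_seq [leRHS]big_seq; apply: ler_sum => y.
  rewrite /Y mem_filter => /andP[ey _].
  have [a [b [a0 ab abe yz]]] := dvd_sqr_diff e0 ey zY.
  have G0 c : 0 <= G y c by rewrite addr_ge0.
  have be : (b <= e)%N by rewrite -abe leq_pmull.
  have as' : a \in index_iota 1 s.+1.
    by rewrite mem_index_iota a0 ltnS (leq_trans ab)// (leq_trans be).
  have bs' : b \in index_iota 1 s.+1.
    by rewrite mem_index_iota (leq_trans a0 ab) ltnS (leq_trans be).
  rewrite (bigD1_seq a) ?iota_uniq//= big_mkcond/= (bigD1_seq b) ?iota_uniq//=.
  rewrite ab abe eqxx/= -addrA -[leLHS]addr0 lerD//.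
    by rewrite /G; case/orP: yz => ->; rewrite ?lerDl ?lerDr.
  by rewrite addr_ge0 ?sumr_ge0// => [c _|c _]; [case: ifP|apply: sumr_ge0].
rewrite exchange_big/=; apply: ler_sum_nat => a _.
rewrite exchange_big/= big_seq_cond [leRHS]big_seq_cond; apply: ler_sum => b.
rewrite mem_index_iota => /andP[/andP[b0 bs] _].
rewrite /G big_split/= ler_pdivlMr ?ltr0n// mulrDl.
have H c : \sum_(y <- Y) (b%:Z %| y - c)%Z%:R * b%:R <= (3 * s)%:R :> rat.
  have := size_progression c b0 bs; rewrite -(@ler_nat rat); apply: le_trans.
  rewrite natrM -mulr_suml ler_wpM2r//.
  rewrite -sum1_size natr_sum big_filter [leRHS]big_mkcond/=.
  apply: (@le_trans _ _ (\sum_(y <- zrange s) (b%:Z %| y - c)%Z%:R)).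
    apply: ler_sum_subset; rewrite ?filter_uniq ?uniq_zrange//.
    by move=> y; rewrite /Y mem_filter => /andP[].
  by apply: ler_sum => y _; case: ifP.
have -> : (6 * s)%:R = (3 * s)%:R + (3 * s)%:R :> rat.
  by rewrite -natrD; congr _%:R; lia.
by apply: lerD; rewrite mulr_suml// -[z]opprK.
Qed.

(** Of two complementary divisors the larger one dominates, which confines the
    smaller one to [1, sqrt m]: only moduli up to [s] matter below. *)
Lemma sigma4_le_half (m : int) : 0 < m ->
  sigma4 (4 * m) <= 2 * \sum_(w <- quarter_pairs (4 * m) | w.1 <= w.2) w.2.
Proof.
move=> m0; set S := \sum_(w <- _ | _) _; have -> : 2 * S = S + S by ring.
rewrite /sigma4 (bigID (fun w => w.1 <= w.2))/=; apply: lerD.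
  exact: ler_sum.
pose swap (w : int * int) := (w.2, w.1).
rewrite -[leLHS]big_filter /S -[leRHS]big_filter.
rewrite (@big_seq_bij _ _ _ _ _
  [seq w <- quarter_pairs (4 * m) | w.1 < w.2] _ swap swap)/=.
- apply: ler_sum_subset; do ?exact/filter_uniq/uniq_quarter_pairs.
    move=> w; rewrite [in X in X -> _]mem_filter [in X in _ -> X]mem_filter.
    by move=> /andP[/ltW-> ->].
  by move=> w; rewrite !(mem_quarter_pairs, mem_filter) => /and4P[_ _ /ltW].
- exact/filter_uniq/uniq_quarter_pairs.
- exact/filter_uniq/uniq_quarter_pairs.
- move=> w; rewrite !(mem_quarter_pairs, mem_filter) -ltNge/= => /and4P[-> -> -> /eqP <-].
  by rewrite [w.2 * _]mulrC eqxx.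
- move=> w; rewrite !(mem_quarter_pairs, mem_filter) -ltNge/= => /and4P[-> -> -> /eqP <-].
  by rewrite [w.2 * _]mulrC eqxx.
- by case.
- by case.
Qed.

Lemma sigma4_le_sqrt (s : nat) (m : int) : 0 < m -> m <= s%:Z ^+ 2 ->
  ((sigma4 (4 * m))%:~R : rat) <=
  2 * \sum_(1 <= e < s.+1 | (e%:Z %| m)%Z) (s ^ 2)%:R / e%:R.
Proof.
move=> m0 ms.
apply: (@le_trans _ _
  ((2 * \sum_(w <- quarter_pairs (4 * m) | w.1 <= w.2) w.2)%:~R)).
  by rewrite ler_int sigma4_le_half.
rewrite rmorphM/= ler_wpM2l// rmorph_sum/= -big_filter -[leRHS]big_filter.
set L := seq.filter _ _.
have LP w : w \in L -> [/\ 0 < w.1, w.1 <= w.2 & w.1 * w.2 = m].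
  rewrite !(mem_quarter_pairs, mem_filter) => /and4P[w12 w1 _ /eqP wm].
  by split=> //; apply: (@mulfI _ (4 : int)).
apply: (@le_trans _ _ (\sum_(e <- [seq `|w.1|%N | w <- L]) (s ^ 2)%:R / e%:R)).
  rewrite big_map big_seq [leRHS]big_seq; apply: ler_sum => w /LP[w1 w12 wm].
  have e0 : 0 < (`|w.1|%N)%:R :> rat by rewrite ltr0n; lia.
  rewrite ler_pdivlMr//.
  have : (w.2 * (`|w.1|%N)%:Z)%:~R <= ((s ^ 2)%N%:Z)%:~R :> rat.
    rewrite ler_int (gez0_abs (ltW w1)) mulrC wm.
    by apply: (le_trans ms); rewrite expr2 -PoszM.
  by rewrite intrM.
apply: ler_sum_subset.
- rewrite map_inj_in_uniq; first exact/filter_uniq/uniq_quarter_pairs.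
  move=> [a b] [c d] /LP[/= a0 _ ab] /LP[/= c0 _ cd] ac.
  have {}ac : a = c by lia.
  by move: cd; rewrite -ac -ab => /mulfI; rewrite gt_eqF// => ->.
- by rewrite filter_uniq ?iota_uniq.
- move=> e /mapP[w /LP[w1 w12 wm] ->].
  rewrite mem_filter mem_index_iota gez0_abs ?ltW//; apply/andP; split.
    by rewrite -wm dvdz_mulr.
  have ws : w.1 ^+ 2 <= s%:Z ^+ 2.
    by apply: le_trans ms; rewrite -wm expr2 ler_pM2l.
  move: ws; rewrite ler_sqr ?nnegrE//; last exact: ltW.
  move=> ws.
  by rewrite absz_gt0 gt_eqF// ltnS -lez_nat (gez0_abs (ltW w1)).
- by move=> e _; rewrite divr_ge0.
Qed.

Lemma rep4_le1 (m : int) : (rep predT 4 m)%:Z <= 1 + 16 * sigma4 (4 * m).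
Proof.
have [m0|m0|->] := ltgtP m 0.
- by rewrite rep_neg// addr_ge0 ?mulr_ge0 ?sigma4_ge0.
- by apply: le_trans (rep4_le m0) _; rewrite lerDr.
apply: (@le_trans _ _ 1); last by rewrite lerDl mulr_ge0 ?sigma4_ge0.
by [].
Qed.

(** The constant covers 3 + 32 * 6 * 4: the trivial part of the range of y, then
    twice the factor 16 of [rep4_le], the factor 6 of [count_sqr_roots] and the
    bound 4 of [sum_inv_triangle]. *)
Lemma rep5_le (s : nat) (n : int) : (0 < s)%N -> n <= s%:Z ^+ 2 ->
  (rep predT 5 n <= 1000 * s ^ 3)%N.
Proof.
move=> s0 ns; rewrite -(@ler_nat rat).
rewrite (repS_zrange _ _ ns) natr_sum/=.
pose D (y : int) : rat :=
  \sum_(1 <= e < s.+1 | (e%:Z %| (n - y ^+ 2)%R)%Z) (s ^ 2)%:R / e%:R.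
have D0 y : 0 <= D y by apply: sumr_ge0 => e _; rewrite divr_ge0.
apply: (@le_trans _ _ (\sum_(y <- zrange s) (1 + 32 * D y))).
  rewrite big_seq [leRHS]big_seq; apply: ler_sum => y ys.
  apply: (@le_trans _ _ (1 + 16 * (sigma4 (4 * (n - y ^+ 2)))%:~R)).
    have := rep4_le1 (n - y ^+ 2); rewrite -(@ler_int rat).
    by rewrite rmorphD/= rmorphM.
  rewrite lerD2l.
  have [ny|ny] := leP (n - y ^+ 2) 0.
    rewrite sigma4_eq0 ?mulr0 ?mulr_ge0// => q q0 /(@mulfI _ (4 : int) isT) nq.
    by rewrite -nq ltNge ny in q0.
  have -> : 32 = 16 * 2 :> rat by rewrite -natrM.
  rewrite -mulrA ler_wpM2l// sigma4_le_sqrt//.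
  by apply: le_trans ns; rewrite lerBlDr lerDl sqr_ge0.
rewrite big_split/= -mulr_sumr /D (exchange_big_dep xpredT)//=.
apply: (@le_trans _ _ ((3 * s)%:R + 32 * ((6 * s ^ 3)%:R * 4))); last first.
  rewrite -!natrM -natrD ler_nat; nia.
apply: lerD.
  rewrite big_const_seq count_predT iter_addr_0 size_zrange ler_nat; lia.
rewrite ler_wpM2l//.
apply: (@le_trans _ _ (\sum_(1 <= e < s.+1) (s ^ 2)%:R / e%:R *
  \sum_(1 <= a < s.+1) \sum_(1 <= b < s.+1 | (a <= b)%N && (a * b == e)%N)
     (6 * s)%:R / b%:R)).
  apply: ler_sum_nat => e /andP[e0 es].
  apply: le_trans (ler_wpM2l _ (count_sqr_roots n e0 es)); last first.
    by rewrite divr_ge0.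
  by rewrite -big_filter big_const_seq count_predT iter_addr_0 -[leLHS]mulr_natr lexx.
under eq_bigr => e _.
  rewrite mulr_sumr; under eq_bigr do rewrite mulr_sumr.
  over.
rewrite exchange_big/=.
apply: (@le_trans _ _ ((6 * s ^ 3)%:R * \sum_(1 <= a < s.+1)
    \sum_(1 <= b < s.+1 | (a <= b)%N) (a%:R * b%:R ^+ 2)^-1)); last first.
  by rewrite ler_wpM2l// sum_inv_triangle.
rewrite mulr_sumr; apply: ler_sum_nat => a /andP[a0 _].
under eq_bigr do rewrite big_mkcond.
rewrite exchange_big/= mulr_sumr [leRHS]big_mkcond/=.
apply: ler_sum_nat => b /andP[b0 _].
have [ab|ab] := leqP a b; last by rewrite big1.
rewrite /=.
apply: (@le_trans _ _
  (\sum_(e <- [:: a * b]%N) (s ^ 2)%:R / e%:R * ((6 * s)%:R / b%:R))).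
  rewrite -big_mkcond -big_filter; apply: ler_sum_subset.
  - by rewrite filter_uniq ?iota_uniq.
  - by [].
  - by move=> e; rewrite mem_filter inE eq_sym => /andP[].
  - by move=> e _; rewrite mulr_ge0 ?divr_ge0.
rewrite big_seq1 le_eqVlt; apply/orP; left; apply/eqP.
rewrite !natrM; field.
by rewrite !pnatr_eq0; lia.
Qed.

(** * Growth of the number of representations *)

Lemma rep_upper (k : nat) : exists2 C : nat, (0 < C)%N &
  forall (s : nat) (n : int), (0 < s)%N -> n <= s%:Z ^+ 2 ->
    (rep predT (5 + k) n <= C * s ^ (3 + k))%N.
Proof.
elim: k => [|k [C C0 IH]]; first by exists 1000; last exact: rep5_le.
exists (3 * C)%N => [|s n s0 ns]; first by rewrite muln_gt0.
rewrite addnS (repS_zrange _ _ ns)/=.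
apply: (@leq_trans (\sum_(x <- zrange s) C * s ^ (3 + k))).
  by apply: leq_sum => x _; apply: IH => //; rewrite lerBlDr ler_wpDr ?sqr_ge0.
rewrite big_const_seq count_predT iter_addn_0 size_zrange addnS expnS.
have s3 : (`|s|.*2.+1 <= 3 * s)%N by lia.
apply: leq_trans (leq_mul (leqnn _) s3) _.
by move: (s ^ (3 + k))%N => X; lia.
Qed.

Lemma shift_mod8 (n : int) : exists q : int, exists2 t : nat, (t < 8)%N &
  n = 8 * q + 4 + t%:Z.
Proof.
exists ((n - 4) %/ 8)%Z, `|((n - 4) %% 8)%Z|%N; lia.
Qed.

Lemma rep_ge_progression (k : nat) (r : int) (h B : nat) (n : int) :
  (forall j : nat, (j < h)%N ->
    (B <= rep predT k (n - (r + 4 * j%:Z) ^+ 2))%N) ->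
  (h * B <= rep predT k.+1 n)%N.
Proof.
move=> H; have -> : h = size [seq r + 4 * j%:Z | j <- iota 0 h].
  by rewrite size_map size_iota.
apply: rep_ge; last first.
- by move=> x /mapP[j]; rewrite mem_iota => /andP[_ jh] ->; apply: H.
- exact: all_predT.
- by rewrite map_inj_uniq ?iota_uniq// => i j; lia.
Qed.

(** The divisor n / 4 of itself already contributes 16 (n / 4) >= n. *)
Lemma rep4_lower (n : int) : 0 < n -> (exists q, n = 8 * q + 4) ->
  n <= (rep predT 4 n)%:Z.
Proof.
move=> n0 [q nq].
apply: (@le_trans _ _ (rep oddz 4 n)%:Z).
  rewrite jacobi_odd4; last by exists q.
  rewrite /sigma4.
  have qn : (2 * q + 1, 1 : int) \in quarter_pairs n.
    by rewrite mem_quarter_pairs nq; apply/and3P; split; rewrite //=; lia.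
  rewrite (bigD1_seq _ qn) ?uniq_quarter_pairs//= mulrDr.
  have : 0 <= \sum_(w <- quarter_pairs n | w != (2 * q + 1, 1)) w.1.
    rewrite big_seq_cond; apply: sumr_ge0 => w.
    by rewrite mem_quarter_pairs => /andP[/and3P[/ltW]].
  by move: (\sum_(_ <- _ | _) _) => S S0; lia.
rewrite lez_nat; apply: (@size_seq_inj _ _ _ _ id) => //; first exact: uniq_reps.
by move=> t; rewrite !mem_reps => /and3P[-> _ ->]; rewrite all_predT.
Qed.

(** Write n = 8 q + 4 + t with 0 <= t < 8 and t = r_1^2 + ... + r_4^2 where
    0 <= r_i <= 2.  For x_i = r_i + 4 j_i the remainder
    n - x_1^2 - ... - x_4^2 is still 4 mod 8, because
    (r + 4 j)^2 = r^2 + 8 (r j + 2 j^2); it is at least s^2 / 4 as long as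
    j_i <= s / 16, and [rep4_lower] applies to it. *)
Lemma rep8_lower (s : nat) (n : int) : (0 < s)%N -> s%:Z ^+ 2 <= n ->
  (s ^ 6 <= 4 * 16 ^ 4 * rep predT 8 n)%N.
Proof.
move=> s0 sn.
(* below 4 the remainder would not be positive; n ones do the job *)
have [n4|n4] := ltP n 4.
  have s1 : s = 1%N by nia.
  rewrite s1 exp1n muln_gt0/= lt0n size_eq0.
  pose ones := nseq `|n| (1 : int) ++ nseq (8 - `|n|) 0.
  have : ones \in reps predT 8 n.
    rewrite mem_reps size_cat !size_nseq all_predT big_cat/=.
    rewrite !big_nseq !iter_addr_0; apply/andP; split; first lia.
    by rewrite expr0n/= mul0rn addr0 expr1n natz; lia.
  by apply: contraTneq => ->.
have [q [t t8 nq]] := shift_mod8 n.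
have q0 : 0 <= q by lia.
have [r1 [r2 [r3 [r4 [rt r12 r34]]]]] : exists r1 r2 r3 r4 : int,
   [/\ r1 ^+ 2 + r2 ^+ 2 + r3 ^+ 2 + r4 ^+ 2 = t%:Z,
       (0 <= r1 <= 2) && (0 <= r2 <= 2) & (0 <= r3 <= 2) && (0 <= r4 <= 2)].
  have : (t < 8)%N by []; move: (t) => u.
  do 8?[case: u => [|u]]; last by [].
  - by exists 0, 0, 0, 0.
  - by exists 1, 0, 0, 0.
  - by exists 1, 1, 0, 0.
  - by exists 1, 1, 1, 0.
  - by exists 2, 0, 0, 0.
  - by exists 2, 1, 0, 0.
  - by exists 2, 1, 1, 0.
  - by exists 2, 1, 1, 1.
pose h := (s %/ 16).+1.
have hs : (s <= 16 * h)%N by rewrite /h; lia.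
(* s ^ 2 / 4 rounded up *)
pose B := ((s ^ 2).+3 %/ 4)%N.
have sB : (s ^ 2 <= 4 * B)%N by rewrite /B; lia.
have h_bound : s%:Z ^+ 2 <= 4 * (8 * q + 4 - 64 * (h%:Z * (h%:Z - 1))).
  rewrite /h; have := divn_eq s 16; have : (s %% 16 < 16)%N by rewrite ltn_mod.
  move: (s %/ 16)%N (s %% 16)%N => g r r16 sE.
  by have [g0|g0] := posnP g; [subst g|]; nia.
have sqE (r : int) (j : nat) : 0 <= r <= 2 -> (j < h)%N ->
    exists2 w : int, (r + 4 * j%:Z) ^+ 2 = r ^+ 2 + 8 * w &
      w <= 2 * (h%:Z * (h%:Z - 1)).
  move=> r02 jh; exists (r * j%:Z + 2 * j%:Z ^+ 2); first by ring.
  have jh' : j%:Z + 1 <= h%:Z by lia.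
  have rj : r * j%:Z <= 2 * j%:Z by rewrite ler_wpM2r//; case/andP: r02.
  have jj : j%:Z * (j%:Z + 1) <= (h%:Z - 1) * h%:Z.
    by rewrite ler_pM// lerBrDr.
  by move: rj jj; lia.
have main : (h * (h * (h * (h * B))) <= rep predT 8 n)%N.
  have /andP[r1b r2b] := r12; have /andP[r3b r4b] := r34.
  apply: (@rep_ge_progression _ r1) => j1 /(sqE _ _ r1b)[w1 -> w1b].
  apply: (@rep_ge_progression _ r2) => j2 /(sqE _ _ r2b)[w2 -> w2b].
  apply: (@rep_ge_progression _ r3) => j3 /(sqE _ _ r3b)[w3 -> w3b].
  apply: (@rep_ge_progression _ r4) => j4 /(sqE _ _ r4b)[w4 -> w4b].
  set m := (X in rep _ _ X).
  have mE : m = 8 * (q - w1 - w2 - w3 - w4) + 4 by rewrite /m nq -rt; ring.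
  have ms : s%:Z ^+ 2 <= 4 * m.
    by apply: le_trans h_bound _; rewrite mE; lia.
  have m0 : 0 < m.
    by rewrite -(@pmulr_rgt0 _ 4)//; apply: lt_le_trans ms; rewrite exprn_gt0.
  have := rep4_lower m0 (ex_intro _ _ mE).
  move: ms; rewrite /B; move: (rep _ _ _) => N.
  by lia.
apply: leq_trans (_ : _ <= (16 * h) ^ 4 * (4 * B))%N _.
  have -> : (s ^ 6 = s ^ 4 * s ^ 2)%N by rewrite -expnD.
  by rewrite leq_mul// leq_exp2r.
rewrite expnMn; move: (16 ^ 4)%N => K.
apply: leq_trans (leq_mul (leqnn (4 * K)) main).
by rewrite leq_eqVlt; apply/orP; left; apply/eqP; rewrite !expnS expn0; ring.
Qed.

(** A new coordinate x < h, where h is half of s rounded up, leaves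
    n - x^2 >= (2 h - 1)^2 - (h - 1)^2 >= h^2: each of the h choices can be
    completed as for h. *)
Lemma rep_lower (k : nat) : exists2 C : nat, (0 < C)%N &
  forall (s : nat) (n : int), (0 < s)%N -> s%:Z ^+ 2 <= n ->
    (s ^ (6 + k) <= C * rep predT (8 + k) n)%N.
Proof.
elim: k => [|k [C C0 IH]]; first by exists (4 * 16 ^ 4)%N; last exact: rep8_lower.
exists (C * 2 ^ (6 + k).+1)%N => [|s n s0 sn].
  by rewrite muln_gt0 C0 expn_gt0.
pose h := uphalf s.
have h0 : (0 < h)%N by rewrite /h; lia.
have hs : (s <= 2 * h)%N by rewrite /h; lia.
have step : (h * h ^ (6 + k) <= C * rep predT (8 + k).+1 n)%N.
  (* h ^ (6 + k) / C rounded up *)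
  pose B := ((h ^ (6 + k) + C.-1) %/ C)%N.
  have hB : (h ^ (6 + k) <= C * B)%N.
    by rewrite /B mulnC; move: C0 (_ ^ _)%N => ? x; lia.
  apply: (@leq_trans (C * (h * B))); first by rewrite mulnCA leq_mul.
  rewrite leq_mul//; have -> : h = size [seq j%:Z | j <- iota 0 h].
    by rewrite size_map size_iota.
  apply: rep_ge; last first.
  - move=> x /mapP[j]; rewrite mem_iota => /andP[_ jh] ->.
    have := IH h (n - j%:Z ^+ 2) h0.
    have jn : h%:Z ^+ 2 <= n - j%:Z ^+ 2 by nia.
    move=> /(_ jn); rewrite /B; move: (_ ^ _)%N (rep _ _ _) => X Y XY.
    rewrite -ltnS ltn_divLR// mulSn; lia.
  - exact: all_predT.
  - by rewrite map_inj_uniq ?iota_uniq// => i j [].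
apply: leq_trans (_ : (2 * h) ^ (6 + k).+1 <= _)%N; first by rewrite leq_exp2r.
rewrite expnMn expnS [X in (_ * X <= _)%N]expnS addnS.
by rewrite mulnC [leqRHS]mulnAC leq_mul// .
Qed.

(** * Fibers of the difference map on the bilinear sphere *)

Definition bisphere_seq (d lam : nat) : seq (lattice d * lattice d) :=
  fset_set (bisphere d lam).

Lemma mem_bisphere_seq d lam w :
  (w \in bisphere_seq d lam) = (sqnorm w.1 + sqnorm w.2 == lam%:Z).
Proof.
rewrite in_fset_set; last exact: finite_bisphere.
by apply/idP/eqP => [/set_mem|H]; last exact: mem_set.
Qed.

Lemma uniq_bisphere_seq d lam : uniq (bisphere_seq d lam).
Proof. exact: fset_uniq. Qed.

Lemma size_bisphere_seq d lam : size (bisphere_seq d lam) = bisphere_card d lam.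
Proof. by rewrite /bisphere_card cardfE. Qed.

Lemma bisphere_card_ge d lam :
  (rep predT (d + d) lam%:Z <= bisphere_card d lam)%N.
Proof.
rewrite -size_bisphere_seq.
pose h (t : seq int) : lattice d * lattice d :=
  (\row_(i < d) t`_i, \row_(i < d) t`_(d + i)).
apply: (@size_seq_inj _ _ _ _ h); first exact: uniq_reps.
  move=> t; rewrite mem_reps mem_bisphere_seq => /and3P[/eqP st _ /eqP <-].
  rewrite /sqnorm/= (big_nth 0) big_mkord st big_split_ord/=.
  by apply/eqP; congr (_ + _); apply: eq_bigr => i _; rewrite mxE.
move=> t u; rewrite !mem_reps => /and3P[/eqP st _ _] /and3P[/eqP su _ _].
case=> /rowP h1 /rowP h2; apply: (@eq_from_nth _ 0); first by rewrite st su.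
move=> i; rewrite st => idd; have [id'|di] := ltnP i d.
  by have := h1 (Ordinal id'); rewrite !mxE.
have id' : (i - d < d)%N by lia.
by have := h2 (Ordinal id'); rewrite !mxE/= subnKC.
Qed.

Definition fiber_count (d lam : nat) (v : lattice d) : nat :=
  count (fun w => w.1 - w.2 == v) (bisphere_seq d lam).

(** The parallelogram law: |u + v|^2 = 2 lam - |u - v|^2, and u + v together
    with u - v determines (u, v). *)
Lemma fiber_count_le (d lam : nat) (v : lattice d) :
  (fiber_count lam v <= rep predT d (2 * lam%:Z - sqnorm v))%N.
Proof.
rewrite /fiber_count -size_filter.
pose h (w : lattice d * lattice d) : seq int :=
  [seq w.1 ord0 i + w.2 ord0 i | i <- enum 'I_d].
apply: (@size_seq_inj _ _ _ _ h).
- exact/filter_uniq/uniq_bisphere_seq.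
- move=> [a b]; rewrite mem_filter mem_bisphere_seq => /andP[/eqP <- /eqP abl].
  rewrite mem_reps -abl size_map size_enum_ord eqxx all_predT big_map big_enum/=.
  rewrite /sqnorm -big_split/= mulr_sumr -sumrB; apply/eqP; apply: eq_bigr => i _.
  by rewrite !mxE; ring.
move=> [a b] [a' b']; rewrite !mem_filter => /andP[/eqP ab _] /andP[/eqP ab' _].
move=> /eq_in_map hE; have {}hE i : a ord0 i + b ord0 i = a' ord0 i + b' ord0 i.
  by apply: hE; rewrite mem_enum.
have dE i : a ord0 i - b ord0 i = a' ord0 i - b' ord0 i.
  by have /rowP/(_ i) := etrans ab (esym ab'); rewrite !mxE.
by congr (_, _); apply/rowP => i; have := hE i; have := dE i;
  move: (a _ i) (b _ i) (a' _ i) (b' _ i) => x y z t; lia.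
Qed.

(** [s] is the integer square root of [lam].  As 2 lam <= (3 s)^2, the fibers
    have at most C s^(d-2) points, against at least c s^(2d-2) on the sphere. *)
Lemma fiber_ratio (d : nat) : (5 <= d)%N -> exists2 C : nat, (0 < C)%N &
  forall lam : nat, (0 < lam)%N -> exists s : nat,
    [/\ (0 < s)%N, (lam <= 4 * s ^ 2)%N & forall v : lattice d,
      (fiber_count lam v * s ^ d <= C * bisphere_card d lam)%N].
Proof.
move=> d5; have [k dk] : exists k, d = (5 + k)%N by exists (d - 5)%N; lia.
have [A A0 upper] := rep_upper k; have [B B0 lower] := rep_lower (2 + 2 * k).
exists (A * 3 ^ (3 + k) * B)%N.
  by rewrite muln_gt0 B0 andbT muln_gt0 A0 expn_gt0.
move=> lam lam0.
have [s [s1 s2]] : exists s : nat, (s ^ 2 <= lam)%N /\ (lam < s.+1 ^ 2)%N.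
  elim: lam {lam0} => [|n [s [sn ns]]]; first by exists 0%N.
  have [?|?] := ltnP n.+1 (s.+1 ^ 2)%N; last by exists s.+1; split=> //; lia.
  by exists s; split => //; lia.
have s0 : (0 < s)%N by case: s {s1} s2 => //; lia.
exists s; split=> // [|v]; first by nia.
have low : (s ^ (8 + 2 * k) <= B * bisphere_card d lam)%N.
  have -> : (8 + 2 * k = 6 + (2 + 2 * k))%N by lia.
  apply: (leq_trans (lower s lam%:Z s0 _)); first by lia.
  have -> : (8 + (2 + 2 * k) = d + d)%N by lia.
  by rewrite leq_mul// bisphere_card_ge.
have up : (fiber_count lam v <= A * (3 * s) ^ (3 + k))%N.
  apply: leq_trans (fiber_count_le _ _) _.
  have := sqnorm_ge0 v; move: (sqnorm v) => x x0; rewrite dk.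
  apply: upper; first lia.
  nia.
apply: leq_trans (leq_mul up (leqnn _)) _.
rewrite -[leqRHS]mulnA; apply: leq_trans (leq_mul (leqnn _) low).
by rewrite expnMn mulnA -[leqLHS]mulnA -expnD leq_mul// leq_pexp2l//; lia.
Qed.

(** * Convexity and the counting measure *)

(** Young's inequality a / m <= (a / m)^p / p + 1 / q for the bound [m] to be
    proved, summed over the list. *)
Lemma power_mean (R : realType) (T : eqType) (s : seq T) (a : T -> R) (p A : R) :
  1 < p -> 0 <= A -> (forall x, 0 <= a x) ->
  \sum_(x <- s) a x `^ p <= (size s)%:R * A ->
  \sum_(x <- s) a x <= (size s)%:R * A `^ p^-1.
Proof.
move=> p1 A0 a0 aA.
have p0 : 0 < p by apply: lt_trans p1.
have [A0'|A0'] := eqVneq A 0.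
  have a_eq0 x : x \in s -> a x = 0.
    move=> xs; apply/eqP; have : \sum_(x <- s) a x `^ p == 0.
      rewrite eq_le sumr_ge0 ?andbT => [|y _]; last exact: powR_ge0.
      by rewrite (le_trans aA)// A0' mulr0.
    rewrite psumr_eq0 => [/allP/(_ _ xs)/=|y _]; last exact: powR_ge0.
    by rewrite powR_eq0 => /andP[].
  by rewrite big_seq big1// mulr_ge0// powR_ge0.
have {}A0 : 0 < A by rewrite lt_def A0' A0.
pose m := A `^ p^-1.
have m0 : 0 < m by rewrite powR_gt0.
have mp : m `^ p = A by rewrite /m -powRrM mulVf ?powRr1 ?gt_eqF// ltW.
pose q := p / (p - 1).
have q0 : 0 < q by rewrite divr_gt0// subr_gt0.
have pq : p^-1 + q^-1 = 1.
  by rewrite /q invf_div mulrBl mul1r divff ?gt_eqF// addrC subrK.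
have young x : a x <= m * (a x `^ p / (A * p) + q^-1).
  rewrite -ler_pdivrMl// mulrC.
  apply: le_trans (_ : _ <= (a x / m) * 1) _; first by rewrite mulr1.
  apply: le_trans (conjugate_powR _ _ p0 q0 pq) _ => //.
    by rewrite divr_ge0// ltW.
  have -> : (a x / m) `^ p = a x `^ p / A.
    rewrite powRM ?invr_ge0 ?(ltW m0)//; congr (_ * _).
    apply: (mulIf (_ : A != 0)); rewrite ?gt_eqF// mulVf ?gt_eqF// -{1}mp.
    by rewrite -powRM ?invr_ge0 ?(ltW m0)// mulVf ?gt_eqF// powR1.
  by rewrite powR1 mul1r lerD2r -mulrA -invfM.
apply: le_trans (ler_sum _ (fun x _ => young x)) _.
rewrite -mulr_sumr mulrC -/m ler_pM2r// big_split/= -mulr_suml.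
rewrite big_const_seq count_predT iter_addr_0.
apply: (@le_trans _ _ ((size s)%:R * p^-1 + (size s)%:R * q^-1)).
  apply: lerD; last by rewrite mulr_natl.
  by rewrite invfM mulrA ler_pM2r ?invr_gt0// ler_pdivrMr.
by rewrite -mulrDr pq mulr1.
Qed.

Section counting_lattice.
Variables (R : realType) (d : nat).
Implicit Types (h : lattice d -> \bar R) (F G : lattice d -> R).
Local Notation mu := (@counting (lattice d) R).

Lemma counting_translate (u : lattice d) (A : set (lattice d)) :
  mu ((fun x => x - u) @^-1` A) = mu A.
Proof.
have -> : (fun x => x - u) @^-1` A = (fun x => x + u) @` A.
  apply/seteqP; split=> x /=; first by exists (x - u); rewrite ?subrK.
  by move=> [y Ay <-]; rewrite addrK.
have inj : injective (fun x : lattice d => x + u) by exact: addIr.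
rewrite /counting; case: ifPn => [/asboolP fA|/asboolP nfA].
  have fA' : finite_set A.
    apply: sub_finite_set (finite_image (fun x => x - u) fA) => x Ax.
    by exists (x + u); [exists x | rewrite addrK].
  by rewrite asboolT// fset_set_image// card_imfset.
by rewrite asboolF// => fA; apply: nfA; exact: finite_image.
Qed.

Lemma integral_translate (u : lattice d) h : (forall x, (0 <= h x)%E) ->
  (\int[mu]_x h ((x : lattice d) - u)%R = \int[mu]_x h x)%E.
Proof.
move=> h0.
pose phi := fun x : lattice d => x - u.
have mphi : measurable_fun [set: lattice d] phi by [].
rewrite -[LHS]/(\int[mu]_(x in phi @^-1` setT) (h \o phi) x)%E.
rewrite -(@ge0_integral_pushforward _ _ _ _ R phi mphi mu)//.
by apply: eq_measure_integral => A _ _; exact: counting_translate.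
Qed.

(** [h] dominates its restriction to the points of [s], a finite combination of
    indicators of singletons, each of measure 1. *)
Lemma sum_le_integral (s : seq (lattice d)) h : uniq s ->
  (forall x, (0 <= h x)%E) -> (\sum_(x <- s) h x <= \int[mu]_x h x)%E.
Proof.
move=> us h0.
have -> : (\sum_(x <- s) h x =
    \int[mu]_y \sum_(x <- s) (h x * (\1_[set x] y)%:E))%E.
  rewrite ge0_integral_sum//.
    apply: eq_bigr => x _; rewrite ge0_integralZl//.
    rewrite integral_indic// setIT/= /counting asboolT//.
    by rewrite fset_set1 cardfs1 mule1.
  by move=> x y _; rewrite mule_ge0// lee_fin.
apply: ge0_le_integral => //.
- by move=> y _; apply: sume_ge0 => x _; rewrite mule_ge0// lee_fin.
move=> y _; have [ys|ys] := boolP (y \in s).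
  rewrite (bigD1_seq y)//= big1 ?adde0; first by rewrite indicE mem_set// mule1.
  by move=> x xy; rewrite indicE memNset ?mule0//= => yx; rewrite yx eqxx in xy.
rewrite big_seq big1// => x xs; rewrite indicE memNset ?mule0//= => yx.
by rewrite yx xs in ys.
Qed.

End counting_lattice.

Section average.
Variables (R : realType) (d : nat).
Local Notation mu := (@counting (lattice d) R).
Local Notation normc := (@ComplexField.Normc.normc R).

Lemma modulus_ge0 (z : R[i]) : 0 <= normc z.
Proof. by case: z => a b; exact: sqrtr_ge0. Qed.

Lemma normc_bilinear_average lam (f g : lattice d -> R[i]) x :
  normc (bilinear_average lam f g x) <= (bisphere_card d lam)%:R^-1 *
    \sum_(w <- bisphere_seq d lam) normc (f (x - w.1)) * normc (g (x - w.2)).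
Proof.
rewrite /bilinear_average ComplexField.Normc.normcM ComplexField.Normc.normcV.
have -> : normc (bisphere_card d lam)%:R = (bisphere_card d lam)%:R.
  by rewrite -[RHS]/((1 : R) *+ _) -(@ComplexField.Normc.normc1 R); exact: normcMn.
rewrite ler_wpM2l ?invr_ge0//.
rewrite fsbig_finite/=; last exact: finite_bisphere.
rewrite -/(bisphere_seq d lam); elim: (bisphere_seq d lam) => [|w s IHs].
  by rewrite !big_nil ComplexField.Normc.normc0.
rewrite !big_cons; apply: le_trans (@le_normcD R _ _) _.
by rewrite ComplexField.Normc.normcM lerD2l.
Qed.

(** Tonelli and the translation y = x - u. *)
Lemma integral_average_le lam (F G : lattice d -> R) (M : \bar R) :
  (forall x, 0 <= F x) -> (forall x, 0 <= G x) -> (0 <= M)%E ->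
  (forall y, (\sum_(w <- bisphere_seq d lam) (G (y + w.1 - w.2))%:E <=
     (bisphere_card d lam)%:R%:E * M)%E) ->
  (\int[mu]_x ((bisphere_card d lam)%:R^-1 *
    \sum_(w <- bisphere_seq d lam)
       F ((x : lattice d) - w.1) * G ((x : lattice d) - w.2))%:E <=
   M * \int[mu]_x (F x)%:E)%E.
Proof.
move=> F0 G0 M0 GM; set N := bisphere_card d lam.
set B := bisphere_seq d lam.
have FG0 x y : (0 <= (F x * G y)%:E)%E by rewrite lee_fin mulr_ge0.
have IF0 : (0 <= \int[mu]_x (F x)%:E)%E.
  by apply: integral_ge0 => x _; rewrite lee_fin.
have [N0|N0] := posnP N.
  under eq_integral do rewrite N0 invr0 mul0r.
  by rewrite integral0 mule_ge0.
under eq_integral do rewrite EFinM -sumEFin.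
rewrite ge0_integralZl//; last by move=> x _; apply: sume_ge0 => w _.
rewrite ge0_integral_sum//.
have -> : (\sum_(w <- B) \int[mu]_x
      (F ((x : lattice d) - w.1) * G ((x : lattice d) - w.2))%:E =
   \sum_(w <- B) \int[mu]_y (F y * G ((y : lattice d) + w.1 - w.2))%:E)%E.
  apply: eq_bigr => w _.
  rewrite -(@integral_translate _ _ w.1 (fun y => (F y * G (y + w.1 - w.2))%:E))//.
  by apply: eq_integral => x _; rewrite subrK.
rewrite -ge0_integral_sum//.
apply: (@le_trans _ _ (N%:R^-1%:E * \int[mu]_x ((N%:R%:E * M) * (F x)%:E))%E).
  rewrite lee_wpmul2l ?lee_fin ?invr_ge0//; apply: ge0_le_integral => //.
  - by move=> y _; apply: sume_ge0 => w _.
  move=> y _; under eq_bigr do rewrite EFinM.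
  rewrite -ge0_sume_distrr; last by move=> w _; rewrite lee_fin.
  by rewrite muleC lee_wpmul2r ?lee_fin.
rewrite ge0_integralZl//; last 2 first.
- by move=> x _; rewrite lee_fin.
- by rewrite mule_ge0.
by rewrite !muleA -EFinM mulVf ?mul1e// pnatr_eq0 -lt0n.
Qed.

(** Singletons have positive counting measure, so the essential supremum bounds
    every value. *)
Lemma sum_le_ess_sup lam (g : lattice d -> R[i]) (y : lattice d) :
  (\sum_(w <- bisphere_seq d lam) (normc (g (y + w.1 - w.2)))%:E <=
     (bisphere_card d lam)%:R%:E * lpnorm +oo g)%E.
Proof.
have mu1 x : mu [set x] = 1%E by rewrite /counting asboolT// fset_set1 cardfs1.
have bound x : ((normc (g x))%:E <= lpnorm +oo g)%E.
  rewrite /lpnorm unlock.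
  have -> : (0 < mu [set: lattice d])%E.
    apply: (@lt_le_trans _ _ (mu [set x])); first by rewrite mu1 lte01.
    by apply: le_measure; [exact: mem_set|exact: mem_set|].
  have [A [mA A0 sub]] := @ess_sup_ge _ _ _ mu (abse \o (EFin \o (normc \o g))).
  apply: contrapT => nx.
  have Ax : A x by apply: sub => /=; rewrite ger0_norm ?modulus_ge0.
  have : (mu [set x] <= mu A)%E.
    by apply: le_measure; [exact: mem_set|exact: mem_set|move=> _ ->].
  by rewrite A0 mu1 lee_fin ler10.
apply: (@le_trans _ _ (\sum_(w <- bisphere_seq d lam) lpnorm +oo g)%E).
  by apply: lee_sum => w _.
rewrite -size_bisphere_seq; elim: (bisphere_seq d lam) => [|w s IHs].
  by rewrite big_nil mul0e.
by rewrite big_cons /= -addn1 natrD EFinD ge0_muleDl// mul1e addeC leeD2r.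
Qed.

(** Grouping the points (u, v) of the sphere by the value of u - v bounds the sum
    of the p-th powers by K N times a sum over distinct translates of y, hence
    by K N ||g||_p^p; [power_mean] takes the p-th root. *)
Lemma sum_le_lpnorm lam (g : lattice d -> R[i]) (p K : R) (y : lattice d) :
  1 < p -> 0 <= K ->
  (forall v : lattice d,
    (fiber_count lam v)%:R <= K * (bisphere_card d lam)%:R) ->
  ellp p%:E g ->
  (\sum_(w <- bisphere_seq d lam) (normc (g (y + w.1 - w.2)))%:E <=
     (bisphere_card d lam)%:R%:E * ((K `^ p^-1)%:E * lpnorm p%:E g))%E.
Proof.
move=> p1 K0 fK gp.
have p0 : 0 < p by apply: lt_trans p1.
have n0 := modulus_ge0.
have L0 : (0 <= lpnorm p%:E g)%E by exact: Lnorm_ge0.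
have Lfin : lpnorm p%:E g \is a fin_num by rewrite ge0_fin_numE.
set L := fine (lpnorm p%:E g).
have LE : lpnorm p%:E g = L%:E by rewrite fineK.
have L0' : 0 <= L by rewrite fine_ge0.
have sumL (s : seq (lattice d)) : uniq s ->
    \sum_(x <- s) normc (g x) `^ p <= L `^ p.
  move=> us; rewrite -lee_fin -sumEFin -poweR_EFin -LE.
  rewrite /lpnorm poweR_Lnorm ?gt_eqF//.
  rewrite (eq_integral (fun x => (normc (g x) `^ p)%:E)).
    by apply: sum_le_integral => // x; rewrite lee_fin powR_ge0.
  by move=> x _; rewrite /= ger0_norm.
rewrite LE sumEFin -!EFinM lee_fin -size_bisphere_seq.
have -> : K `^ p^-1 * L = (K * L `^ p) `^ p^-1.
  by rewrite powRM ?powR_ge0// -powRrM mulfV ?gt_eqF// powRr1.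
apply: power_mean => //; first by rewrite mulr_ge0 ?powR_ge0.
set B := bisphere_seq d lam.
pose V := undup [seq w.1 - w.2 | w <- B].
have -> : \sum_(w <- B) normc (g (y + w.1 - w.2)) `^ p =
   \sum_(v <- V) (fiber_count lam v)%:R * normc (g (y + v)) `^ p.
  under [RHS]eq_bigr do rewrite /fiber_count -sum1_count natr_sum mulr_suml big_mkcond.
  rewrite exchange_big/=; apply: eq_big_seq => w wB.
  have wV : w.1 - w.2 \in V by rewrite mem_undup; apply/mapP; exists w.
  rewrite (bigD1_seq (w.1 - w.2)) ?undup_uniq//= eqxx mul1r big1 ?addr0 ?addrA//.
  by move=> v; rewrite eq_sym => /negbTE ->.
apply: (@le_trans _ _ (\sum_(v <- V) K * (size B)%:R * normc (g (y + v)) `^ p)).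
  apply: ler_sum => v _; rewrite ler_wpM2r ?powR_ge0// size_bisphere_seq//.
rewrite -mulr_sumr mulrA [_ * K]mulrC ler_wpM2l ?mulr_ge0//.
rewrite -(big_map (fun v => y + v) xpredT (fun x => normc (g x) `^ p)).
by apply: sumL; rewrite map_inj_uniq ?undup_uniq//; exact: addrI.
Qed.
End average.

(** * The estimate for the bilinear average *)

Lemma lpnorm1E (R : realType) (d : nat) (f : lattice d -> R[i]) :
  lpnorm 1%:E f =
  (\int[counting]_x (ComplexField.Normc.normc (f x))%:E)%E.
Proof.
rewrite /lpnorm Lnorm1; apply: eq_integral => x _ /=.
by rewrite ger0_norm ?modulus_ge0.
Qed.

Lemma lpnorm1_average_le (R : realType) (d lam : nat)
    (f g : lattice d -> R[i]) (M : \bar R) :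
  (0 <= M)%E ->
  (forall y : lattice d, (\sum_(w <- bisphere_seq d lam)
      (ComplexField.Normc.normc (g (y + w.1 - w.2)))%:E <=
     (bisphere_card d lam)%:R%:E * M)%E) ->
  (lpnorm 1%:E (bilinear_average lam f g) <= M * lpnorm 1%:E f)%E.
Proof.
move=> M0 gM; rewrite !lpnorm1E.
have n0 (h : lattice d -> R[i]) x : 0 <= ComplexField.Normc.normc (h x).
  exact: modulus_ge0.
apply: le_trans (integral_average_le (n0 f) (n0 g) M0 gM).
apply: ge0_le_integral => //.
- by move=> x _; rewrite lee_fin.
- by move=> x _; rewrite lee_fin; exact: normc_bilinear_average.
Qed.

Lemma fiber_decay (R : realType) (d : nat) : (5 <= d)%N ->
  exists2 C : R, 0 < C & forall (lam : nat) (v : lattice d), (0 < lam)%N ->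
    (fiber_count lam v)%:R <=
      C * lam%:R `^ (- (d%:R / 2)) * (bisphere_card d lam)%:R.
Proof.
move=> /fiber_ratio[C C0 ratio].
exists (C * 2 ^ d)%:R => [|lam v lam0].
  by rewrite ltr0n muln_gt0 C0 expn_gt0.
have [s [s0 ls /(_ v) fs]] := ratio lam lam0.
have l0 : 0 < lam%:R :> R by rewrite ltr0n.
have ls' : lam%:R `^ (d%:R / 2) <= (2 * s)%:R ^+ d :> R.
  have -> : (2 * s)%:R ^+ d = ((2 * s)%:R `^ 2) `^ (d%:R / 2) :> R.
    by rewrite -powRrM mulrC divfK// powR_mulrn.
  apply: ge0_ler_powR; rewrite ?nnegrE ?powR_ge0//.
  by rewrite powR_mulrn// -natrX ler_nat; lia.
rewrite powRN mulrAC ler_pdivlMr ?powR_gt0//.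
apply: le_trans (ler_wpM2l _ ls') _ => //.
rewrite -natrX -!natrM ler_nat expnMn mulnCA -mulnA [leqRHS]mulnCA leq_mul//.
Qed.

Theorem corollary1 (R : realType) (d : nat) (p : \bar R) :
  (5 <= d)%N -> ((d%:R / (d%:R - 2))%:E < p)%E ->
  exists2 C : R, 0 < C &
    forall (lam : nat) (f g : lattice d -> R[i]),
      (0 < lam)%N -> ellp 1%:E f -> ellp p g ->
      (lpnorm 1%:E (bilinear_average lam f g) <=
        (C * lam%:R `^ (- fine (d%:R%:E / (2%:E * p))))%:E
        * lpnorm 1%:E f * lpnorm p g)%E.
Proof.
move=> d5; case: p => [p| _|//]; last first.
  exists 1 => // lam f g lam0 _ _.
  rewrite gt0_muley// invey mule0/= oppr0 powRr0 mulr1 mul1e muleC.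
  apply: lpnorm1_average_le; first exact: Lnorm_ge0.
  exact: sum_le_ess_sup.
rewrite lte_fin => dp.
have d2 : 0 < d%:R - 2 :> R by rewrite subr_gt0 ltr_nat; lia.
have p1 : 1 < p.
  by apply: lt_trans dp; rewrite ltr_pdivlMr// mul1r gtrBl.
have [C C0 decay] := fiber_decay R d5.
exists (C `^ p^-1) => [|lam f g lam0 _ gp]; first by rewrite powR_gt0.
have p0 : 0 < p by apply: lt_trans p1.
have -> : fine (d%:R%:E / (2%:E * p%:E)) = d%:R / 2 / p.
  rewrite -EFinM inver mulf_eq0 gt_eqF//= gt_eqF// -EFinM/= invfM mulrA//.
rewrite muleAC; apply: lpnorm1_average_le.
  by rewrite mule_ge0 ?lee_fin ?mulr_ge0 ?powR_ge0//; exact: Lnorm_ge0.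
move=> y; have K0 : 0 <= C * lam%:R `^ (- (d%:R / 2)).
  by rewrite mulr_ge0 ?powR_ge0 ?ltW.
have := sum_le_lpnorm y p1 K0 (fun v => decay lam v lam0) gp.
by rewrite powRM ?powR_ge0 ?(ltW C0)// -powRrM mulNr.
Qed.
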